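(* Let $\Phi$ be an associative commutative ring with $1$, let $A$ be a finitely generated associative commutative $\Phi$-algebra, and let $L$ be a Lie subalgebra of $\mathrm{Der}(A)$ that consists of locally nilpotent derivations. Then the Lie algebra $L$ is locally nilpotent.
   Context: Algebras are taken with $1$. $\mathrm{Der}(A)$ is the Lie $\Phi$-algebra of $\Phi$-linear derivations of $A$ under the commutator bracket. A derivation $d$ of $A$ is locally nilpotent if for every $a\in A$ there is an integer $n(a)\ge 1$ with $d^{n(a)}(a)=0$. A Lie algebra is locally nilpotent if every finitely generated subalgebra is nilpotent. *)

(* Defs.v *)
From HB Require Import structures.
From mathcomp Require Import all_boot all_algebra.
From mathcomp Require Import ring mathcomp_extra boolp classical_sets functions.

Set Implicit Arguments.
Unset Strict Implicit.
Unset Printing Implicit Defensive.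

Import GRing.Theory.
Local Open Scope ring_scope.
Local Open Scope classical_set_scope.

(* The library's [comAlgType R] requires 1 != 0; the structure below does not,  *)
(* so that the zero algebra is allowed.                                        *)
HB.mixin Record Lmodule_isComPzAlgebra (R : comPzRingType) A
    of GRing.Lmodule R A := {
  algmul : A -> A -> A;
  algone : A;
  algmulA : associative algmul;
  algmulC : commutative algmul;
  algmul1 : left_id algone algmul;
  algmulDl : left_distributive algmul +%R;
  algscaleAl : forall (c : R) (a b : A), c *: algmul a b = algmul (c *: a) b
}.

#[short(type="comPzAlgType")]
HB.structure Definition ComPzAlgebra (R : comPzRingType) :=
  {A of GRing.Lmodule R A & Lmodule_isComPzAlgebra R A}.

#[non_forgetful_inheritance]
HB.instance Definition _ (R : comPzRingType) (A : comPzAlgType R) :=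
  GRing.Zmodule_isComPzRing.Build A
    algmulA algmulC algmul1 algmulDl.

Lemma pzscalerAl (R : comPzRingType) (A : comPzAlgType R) (c : R) (a b : A) :
  c *: (a * b) = (c *: a) * b.
Proof. exact: algscaleAl. Qed.

HB.mixin Record Lmodule_isLieAlgebra (R : comPzRingType) g
    of GRing.Lmodule R g := {
  lie : g -> g -> g;
  lie_linearl : forall z, linear (lie^~ z);
  lie_linearr : forall z, linear (lie z);
  liexx : forall x, lie x x = 0;
  lie_jacobi : forall x y z,
    lie x (lie y z) + lie y (lie z x) + lie z (lie x y) = 0
}.

#[short(type="lieAlgType")]
HB.structure Definition LieAlgebra (R : comPzRingType) :=
  {g of GRing.Lmodule R g & Lmodule_isLieAlgebra R g}.

Section Generation.
Variable R : comPzRingType.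

Definition submodule (V : lmodType R) (M : set V) : Prop :=
  M 0 /\ forall (c : R) x y, M x -> M y -> M (c *: x + y).

Definition submodule_gen (V : lmodType R) (S : set V) : set V :=
  \bigcap_(M in [set M | submodule M /\ S `<=` M]) M.

Definition subalgebra (A : comPzAlgType R) (B : set A) : Prop :=
  [/\ submodule B, B 1 & forall a b, B a -> B b -> B (a * b)].

Definition subalgebra_gen (A : comPzAlgType R) (S : set A) : set A :=
  \bigcap_(B in [set B | subalgebra B /\ S `<=` B]) B.

Definition fin_gen_algebra (A : comPzAlgType R) : Prop :=
  exists s : seq A, subalgebra_gen [set` s] = [set: A].

End Generation.

Section LieTheory.
Variables (R : comPzRingType) (g : lieAlgType R).
Implicit Types H K L S : set g.

Definition lie_subalgebra L : Prop :=
  submodule L /\ forall x y, L x -> L y -> L (lie x y).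

Definition lie_gen S : set g :=
  \bigcap_(L in [set L | lie_subalgebra L /\ S `<=` L]) L.

Definition lie_comm H K : set g :=
  submodule_gen [set z | exists x y, [/\ H x, K y & z = lie x y]].

Fixpoint lower_central L (n : nat) : set g :=
  if n is n'.+1 then lie_comm (lower_central L n') L else L.

Definition lie_nilpotent L : Prop :=
  exists n, lower_central L n = [set 0].

Definition lie_fin_gen L : Prop := exists s : seq g, L = lie_gen [set` s].

Definition lie_locally_nilpotent L : Prop :=
  forall H, lie_subalgebra H -> H `<=` L -> lie_fin_gen H -> lie_nilpotent H.

End LieTheory.

Section Derivations.
Variables (R : comPzRingType) (A : comPzAlgType R).

Definition is_derivation (d : A -> A) : Prop :=
  linear d /\ forall a b, d (a * b) = d a * b + a * d b.

Definition derivation : {pred A -> A} := fun d => `[< is_derivation d >].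

Lemma derivation_submod : submod_closed derivation.
Proof.
have scalAr c (a b : A) : c *: (a * b) = a * (c *: b).
  by rewrite mulrC pzscalerAl mulrC.
split=> [|c d e /asboolP[dlin dM] /asboolP[elin eM]]; apply/asboolP; split.
- by move=> c a b; rewrite /= scaler0 addr0.
- by move=> a b; rewrite /= mul0r mulr0 addr0.
- move=> k a b; change (c *: d (k *: a + b) + e (k *: a + b) =
    k *: (c *: d a + e a) + (c *: d b + e b)).
  by rewrite dlin elin !scalerDr !scalerA (mulrC c k) addrACA.
- move=> a b; change (c *: d (a * b) + e (a * b) =
    (c *: d a + e a) * b + a * (c *: d b + e b)).
  by rewrite dM eM scalerDr mulrDl mulrDr pzscalerAl scalAr addrACA.
Qed.

HB.instance Definition _ :=
  GRing.isSubmodClosed.Build R (A -> A) derivation derivation_submod.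

Record der := Der { der_fun :> A -> A; _ : der_fun \in derivation }.

HB.instance Definition _ := [isSub for der_fun].
HB.instance Definition _ := [Choice of der by <:].
HB.instance Definition _ := [SubChoice_isSubLmodule of der by <:].

Lemma der_linear (d : der) : linear d.
Proof. by case: d => d /= /asboolP[]. Qed.

Lemma der_leibniz (d : der) a b : d (a * b) = d a * b + a * d b.
Proof. by case: d => d /= /asboolP[_]. Qed.

Lemma derP (d e : der) : (forall a, d a = e a) -> d = e.
Proof. by move=> de; apply: val_inj; apply/funext. Qed.

Lemma der_add (d e : der) a : (d + e) a = d a + e a.
Proof. by []. Qed.

Lemma der_scale c (d : der) a : (c *: d) a = c *: d a.
Proof. by []. Qed.

Lemma der0 (a : A) : (0 : der) a = 0.
Proof. by []. Qed.

Lemma der_at0 (d : der) : d 0 = 0.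
Proof.
have := der_linear d 1 0 0; rewrite !scale1r !addr0 => d0.
by apply: (addIr (d 0)); rewrite add0r -d0.
Qed.

Lemma der_atD (d : der) a b : d (a + b) = d a + d b.
Proof. by have := der_linear d 1 a b; rewrite !scale1r. Qed.

Lemma der_atZ (d : der) c a : d (c *: a) = c *: d a.
Proof. by have := der_linear d c a 0; rewrite der_at0 !addr0. Qed.

Lemma der_atN (d : der) a : d (- a) = - d a.
Proof. by rewrite -scaleN1r der_atZ scaleN1r. Qed.

Lemma der_comm_subproof (d e : der) :
  (fun a => d (e a) - e (d a)) \in derivation.
Proof.
apply/asboolP; split=> [c a b|a b] /=.
  by rewrite !(der_atD, der_atZ) scalerBr opprD addrACA.
rewrite !(der_leibniz, der_atD). ring.
Qed.

Definition der_comm (d e : der) : der := Der (der_comm_subproof d e).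

Lemma der_commE d e a : der_comm d e a = d (e a) - e (d a).
Proof. by []. Qed.

Let derE := (der_commE, der_add, der_scale, der_atD, der_atN, der_atZ).

Lemma der_comm_linearl e : linear (der_comm^~ e).
Proof.
by move=> c d d'; apply: derP => a; rewrite !derE scalerBr opprD addrACA.
Qed.

Lemma der_comm_linearr d : linear (der_comm d).
Proof.
by move=> c e e'; apply: derP => a; rewrite !derE scalerBr opprD addrACA.
Qed.

Lemma der_commxx d : der_comm d d = 0.
Proof. by apply: derP => a; rewrite der_commE subrr. Qed.

Lemma der_comm_jacobi d e f :
  der_comm d (der_comm e f) + der_comm e (der_comm f d) +
  der_comm f (der_comm d e) = 0.
Proof. by apply: derP => a; rewrite !derE der0; ring. Qed.

HB.instance Definition _ := Lmodule_isLieAlgebra.Build R der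
  der_comm_linearl der_comm_linearr der_commxx der_comm_jacobi.

Definition locally_nilpotent_der (d : der) : Prop :=
  forall a, exists n, (0 < n)%N /\ iter n d a = 0.

End Derivations.

(* Main.v *)
From HB Require Import structures.
Require Import Defs.
From mathcomp Require Import all_boot all_algebra.
From mathcomp Require Import generic_quotient ring_quotient fraction ring mpoly.
From mathcomp Require Import boolp classical_sets functions.

(** The theorem is proved by an Engel argument for operators that are nilpotent in a
    pointwise sense.  Say that a set [M] of operators acts nilpotently at [v] when
    every sequence [v], [m1 v], [m2 (m1 v)], ... vanishes from some point on; this
    is the inductive predicate [tnil].  If a Lie algebra generated by a finite set
    [t] acts nilpotently at each of the finitely many generators of [A], then all
    long words in [t] kill these generators, and the Lie algebra is nilpotent
    ([engel_words], [words_nilpotent]).  So the task is to show that a Lie algebra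
    [L] of locally nilpotent derivations acts nilpotently on the ring.

    The core is Jacobson's form of Engel's theorem.  If [J] acts nilpotently and a
    locally nilpotent [e] normalizes [J], then [J] and [e] together act nilpotently
    ([engel_step]).  Let [M] be maximal among the weakly closed subsets of [L] that
    act nilpotently, both on the given module and by brackets on [L].  If [M] is not
    [L], nilpotency on [L] provides [e] outside [M] with [[M, e]] in [M],
    which contradicts maximality ([engel_zorn]).

    What is not formal is the existence of a maximal [M], for the union of a chain of
    sets acting nilpotently need not act nilpotently.  It does when [L] acts by
    derivations on a field [F] and semilinearly on a finite dimensional space over
    [F] ([union_module]): the vectors invariant under the members of the chain form a
    decreasing chain of spaces over the field of constants, of bounded dimension,
    because invariant vectors that are independent over the constants are
    independent over [F].  So the chain has a common invariant vector, and a flag of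
    such vectors reduces the question to [F] itself, where it is settled by
    induction on the rank of [L] over [F] ([union_field]).

    To reach this situation, finitely many coefficients are collected, and [A] is
    replaced by a polynomial ring over the integers modulo an ideal, which is
    noetherian ([hilbert_basis]).  A noetherian induction leads to a subquotient
    [P / Q], stable under [L], all of whose nonzero stable submodules have the same
    annihilator [q]; the elements that [L] kills modulo [q] then act injectively on
    it, unless they lie in [q].  If a prime number [p] lies in [q], then
    [p]-th powers are such elements, and through the Frobenius [P / Q] is a torsion
    free module of finite type over a domain on which [L] acts trivially
    ([engel_characteristic_p]).  Otherwise [q] is a prime ideal stable under [L], and
    [P / Q] is torsion free over [A / q] ([engel_characteristic_0]).  In both cases
    localization embeds [P / Q] into a finite dimensional space over a field, with a
    semilinear action ([localized_engel]). *)

Set Implicit Arguments.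
Unset Strict Implicit.
Unset Printing Implicit Defensive.

Import GRing.Theory.
Local Open Scope ring_scope.
Local Open Scope classical_set_scope.

(** * Pointwise nilpotency and Engel's theorem *)

Definition additive_map (V W : zmodType) (d : V -> W) : Prop :=
  forall x y, d (x + y) = d x + d y.

Lemma additive_map0 (V W : zmodType) (d : V -> W) : additive_map d -> d 0 = 0.
Proof.
by move=> dD; apply: (addIr (d 0)); rewrite add0r -dD addr0.
Qed.

Lemma additive_mapN (V W : zmodType) (d : V -> W) x : additive_map d -> d (- x) = - d x.
Proof.
by move=> dD; apply: (addIr (d x)); rewrite -dD !addNr additive_map0.
Qed.

Lemma additive_mapB (V W : zmodType) (d : V -> W) x y :
  additive_map d -> d (x - y) = d x - d y.
Proof. by move=> dD; rewrite dD additive_mapN. Qed.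

Definition leibniz (R : pzRingType) (d : R -> R) : Prop :=
  forall a b, d (a * b) = d a * b + a * d b.

Lemma leibniz1 (R : pzRingType) (d : R -> R) : leibniz d -> d 1 = 0.
Proof.
move=> dM; have := dM 1 1; rewrite !mulr1 mul1r => h.
by apply: (addIr (d 1)); rewrite add0r -h.
Qed.

Section Tnil.
Variables (I V : Type) (act : I -> V -> V).

(** Inductive form of: every sequence [v], [m1 v], [m2 (m1 v)], ... with the [mi]
    in [M] enters [B].  As an inductive predicate it allows transfinite
    induction along the action without ordinals, and it does not ask for a bound
    on the length of the sequences, which does not exist when [M] is not
    finitely generated (think of the derivations [f(x) d/dy] and [d/dx]). *)
Inductive tnil (M : set I) (B : set V) : V -> Prop :=
| tnil_base v of B v : tnil M B v
| tnil_step v of (forall m, M m -> tnil M B (act m v)) : tnil M B v.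

Lemma tnil_trans (M : set I) (B B' : set V) v :
  (forall w, B w -> tnil M B' w) -> tnil M B v -> tnil M B' v.
Proof. by move=> h; elim=> [w /h//|w _ ih]; apply: tnil_step. Qed.

Lemma tnil_act (M : set I) (B : set V) m v :
    (forall m w, M m -> B w -> B (act m w)) -> M m ->
  tnil M B v -> tnil M B (act m v).
Proof. by move=> h Mm; case=> [w /h Bw|w hw]; [apply: tnil_base; exact: Bw|exact: hw]. Qed.

(** Follow the action from [v] until the next step falls into [S].  It plays the
    part of the common eigenvector in the classical Engel theorem: it produces
    invariants modulo [S]. *)
Lemma tnil_descent (M : set I) (B E S : set V) v :
    (forall m w, M m -> E w -> E (act m w)) -> (forall w, E w -> B w -> S w) ->
    tnil M B v -> E v -> ~ S v ->
  exists u, [/\ E u, ~ S u & forall m, M m -> S (act m u)].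
Proof.
move=> hE hB; elim=> [w Bw Ew []|w _ ih Ew Sw]; first exact: hB.
case: (pselect (forall m, M m -> S (act m w))) => [h|]; first by exists w.
by move=> /existsNP[m /not_implyP[Mm nS]]; apply: (ih m) => //; apply: hE.
Qed.

Lemma tnil_iter (M : set I) (B : set V) m v :
    (forall w, B w -> B (act m w)) -> M m ->
  tnil M B v -> exists k, B (iter k (act m) v).
Proof.
move=> hB Mm; elim=> [w Bw|w _ ih]; first by exists 0%N.
by have [k Bk] := ih m Mm; exists k.+1; rewrite iterSr.
Qed.

End Tnil.

(** Actions are compared through simulations rather than through equivariant
    maps, since the maps at hand are equivariant on a stable subset only. *)
Lemma tnil_sim (I V I' V' : Type) (act : I -> V -> V) (act' : I' -> V' -> V')
    (M : set I) (M' : set I') (B : set V) (B' : set V') (R : V -> V' -> Prop) v v' :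
    (forall v v', R v v' -> B v -> B' v') ->
    (forall v v' m', R v v' -> M' m' -> exists2 m, M m & R (act m v) (act' m' v')) ->
  tnil act M B v -> R v v' -> tnil act' M' B' v'.
Proof.
move=> hB hM tv; elim: tv v' => [w Bw v' /hB h|w _ ih v' Rw].
  by apply: tnil_base; apply: h.
apply: tnil_step => m' M'm'; have [m Mm Rm] := hM _ _ _ Rw M'm'.
exact: ih Rm.
Qed.

Lemma tnil_sub (I V : Type) (act : I -> V -> V) (M M' : set I) (B : set V) v :
  M' `<=` M -> tnil act M B v -> tnil act M' B v.
Proof.
move=> h tv; apply: (tnil_sim (R := eq)) tv erefl => [? _ <-//|? _ m <- /h Mm].
by exists m.
Qed.

Lemma tnil_add (I : Type) (V : zmodType) (act : I -> V -> V)
    (M : set I) (B : set V) u v :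
    (forall m, M m -> additive_map (act m)) ->
    (forall m w, M m -> B w -> B (act m w)) ->
    (forall x y, B x -> B y -> B (x + y)) ->
  tnil act M B u -> tnil act M B v -> tnil act M B (u + v).
Proof.
move=> hadd hB BD tu; elim: tu v => [{}u Bu v tv|{}u _ ih v tv].
  elim: tv u Bu => [{}v Bv|{}v _ ih] u Bu; first by apply/tnil_base/BD.
  by apply: tnil_step => m Mm; rewrite hadd //; apply: ih => //; apply: hB.
by apply: tnil_step => m Mm; rewrite hadd //; apply: ih => //; apply: tnil_act.
Qed.

(** Engel's induction step.  If [S] missed a point of [E], then [J] would have an
    invariant [u] modulo [S] outside [S]; as [e] normalizes [J] it preserves such
    invariants, and as [e] is locally nilpotent its last iterate outside [S] is
    invariant under [e] as well, hence belongs to [S] after all.  The last two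
    hypotheses are the only consequences needed of the normalization of [J] by
    [e] and of the fact that [J] and [e] span the larger set. *)
Lemma engel_step (I : Type) (V : Type) (act : I -> V -> V) (J : set I) (e : I)
    (B E S : set V) :
    (forall j u, J j -> E u -> E (act j u)) -> (forall u, E u -> E (act e u)) ->
    B `<=` S -> (forall u, E u -> tnil act J B u) ->
    (forall u, E u -> exists k, S (iter k (act e) u)) ->
    (forall u, E u -> (forall j, J j -> S (act j u)) ->
      forall j, J j -> S (act j (act e u))) ->
    (forall u, E u -> (forall j, J j -> S (act j u)) -> S (act e u) -> S u) ->
  E `<=` S.
Proof.
move=> EJ Ee BS tE eE nrm clo v Ev; apply: contrapT => nSv.
have [u [Eu nSu hu]] : exists u, [/\ E u, ~ S u & forall j, J j -> S (act j u)].
  apply: tnil_descent (tE v Ev) Ev nSv => [|w _ /BS //]; exact: EJ.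
have [k] := eE u Eu; elim: k u Eu nSu hu => [//|k ih] u Eu nSu hu.
rewrite iterSr => hk; apply: (ih (act e u)) => //; first exact: Ee.
  by move=> Seu; apply/nSu/clo.
exact: nrm.
Qed.

Section EngelZorn.
Variable V : zmodType.
Implicit Types (d e : V -> V) (M L : set (V -> V)).

Definition comm d e : V -> V := fun v => d (e v) - e (d v).

(** Jacobson's notion, for sets rather than subspaces: it survives the addition of
    a single element, and the sign of the bracket can be ignored. *)
Definition weakly_closed M := forall d e, M d -> M e -> M (comm d e) \/ M (comm e d).

Definition app d (v : V) := d v.

Variables (L : set (V -> V)) (P Q : set V) (ys : seq V).
Hypothesis Ladd : forall d, L d -> additive_map d.
Hypothesis Lcomm : forall d e, L d -> L e -> L (comm d e).
Hypothesis Q0 : Q 0.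
Hypothesis QB : forall x y, Q x -> Q y -> Q (x - y).
Hypothesis QP : Q `<=` P.
Hypothesis LP : forall d y, L d -> P y -> P (d y).
Hypothesis LQ : forall d y, L d -> Q y -> Q (d y).
Hypothesis Lnil : forall d y, L d -> P y -> exists k, Q (iter k d y).
Let Z : set (V -> V) := fun u => forall y, P y -> Q (u y).
Hypothesis ysP : forall y, y \in ys -> P y.
Hypothesis ysdet : forall u, L u -> (forall y, y \in ys -> Q (u y)) -> Z u.

Let chain (F : set (set (V -> V))) :=
  [/\ F !=set0, total_on F subset,
      forall M, F M -> M `<=` L &
      forall M, F M -> weakly_closed M].

(* Unions of chains do not preserve nilpotency in general: this is where
   finiteness conditions enter. *)
Hypothesis unionP : forall F, chain F -> forall y, P y ->
  (forall M, F M -> tnil app M Q y) -> tnil app (\bigcup_(M in F) M) Q y.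
Hypothesis unionL : forall F, chain F -> forall u, L u ->
  (forall M, F M -> tnil comm M Z u) -> tnil comm (\bigcup_(M in F) M) Z u.

Let QN x : Q x -> Q (- x).
Proof. by move=> Qx; rewrite -sub0r; apply: QB. Qed.

Let QD x y : Q x -> Q y -> Q (x + y).
Proof. by move=> Qx Qy; rewrite -[y]opprK; apply: QB => //; apply: QN. Qed.

Let comm_zl d z : L d -> L z -> Z z -> Z (comm z d).
Proof.
by move=> Ld Lz Zz y Py; apply: QB; [apply/Zz/LP|apply/LQ => //; apply: Zz].
Qed.

Let comm_zr d z : L d -> Z z -> Z (comm d z).
Proof.
by move=> Ld Zz y Py; apply: QB; [apply/LQ => //; apply: Zz|apply/Zz/LP].
Qed.

(** By induction on the nilpotency index of [e] at [y], the terms of the binomial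
    expansion of [ad(e)^k u] at [y] eventually vanish; stated for all large [k]
    because finitely many [y] are treated at once in [ad_nil]. *)
Let iter_comm_eventually e u y : L e -> L u -> P y ->
  exists k0, forall k, (k0 <= k)%N -> Q (iter k (comm e) u y).
Proof.
move=> Le Lu Py; have [b] := Lnil Le Py.
have Lit k : L (iter k (comm e) u) by elim: k => //= k; apply: Lcomm.
elim: b y Py => [|b ih] y Py.
  by move=> /= Qy; exists 0%N => k _; apply: LQ.
rewrite iterSr => /(ih _ (LP Le Py))[k0 hk0].
have stepQ k : (k0 <= k)%N ->
    Q (iter k.+1 (comm e) u y - e (iter k (comm e) u y)).
  by move=> lek; rewrite iterS {1}/comm addrAC subrr sub0r; apply/QN/hk0.
have [t0 Qt0] : exists t, Q (iter t e (iter k0 (comm e) u y)).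
  by apply: Lnil => //; apply: LP.
have key t : Q (iter (k0 + t) (comm e) u y - iter t e (iter k0 (comm e) u y)).
  elim: t => [|t iht]; first by rewrite addn0 /= subrr.
  rewrite addnS [iter t.+1 e _]iterS.
  set X := iter (k0 + t)%N _ u y in iht *; set w := iter t e _ in iht *.
  have -> : iter (k0 + t).+1 (comm e) u y - e w =
            (iter (k0 + t).+1 (comm e) u y - e X) + e (X - w).
    by rewrite (additive_mapB _ _ (Ladd Le)) addrA subrK.
  by apply: QD; [apply: stepQ; rewrite leq_addr|apply: LQ].
exists (k0 + t0)%N => k lek.
have Qit t : Q (iter (t0 + t) e (iter k0 (comm e) u y)).
  by elim: t => [|t iht]; rewrite ?addn0 // addnS iterS; apply: LQ.
have -> : k = (k0 + (t0 + (k - (k0 + t0))))%N by rewrite addnA subnKC.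
have := QD (key (t0 + (k - (k0 + t0)))%N) (Qit (k - (k0 + t0))%N).
by rewrite subrK.
Qed.

Let ad_nil e u : L e -> L u -> exists k, Z (iter k (comm e) u).
Proof.
move=> Le Lu.
have Lit k : L (iter k (comm e) u) by elim: k => //= k; apply: Lcomm.
have [k hk] : exists k0, forall k, (k0 <= k)%N -> forall y, y \in ys -> Q (iter k (comm e) u y).
  elim: ys ysP => [_|y s ih hP]; first by exists 0%N.
  have [k1 h1] := ih (fun z zs => hP z (mem_behead (s := y :: s) zs)).
  have [k2 h2] := iter_comm_eventually Le Lu (hP y (mem_head _ _)).
  exists (maxn k1 k2) => k; rewrite geq_max => /andP[le1 le2] z.
  by rewrite inE => /orP[/eqP->|]; [apply: h2|apply: h1].
by exists k; apply: ysdet => //; apply: hk.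
Qed.

Let good M := [/\ M `<=` L, weakly_closed M,
  forall y, P y -> tnil app M Q y & forall u, L u -> tnil comm M Z u].

Let good_bigcup F : F `<=` good -> total_on F subset -> good (\bigcup_(M in F) M).
Proof.
move=> Fg tot; have [[M0 FM0]|F0] := pselect (F !=set0); last first.
  have E : \bigcup_(M in F) M = set0.
    by apply/seteqP; split=> // d [M FM _]; case: F0; exists M.
  by rewrite E; split=> [//|//|y _|u _]; apply: tnil_step.
have wc : forall M, F M -> weakly_closed M by move=> M /Fg[].
have sub : forall M, F M -> M `<=` L by move=> M /Fg[].
have ch : chain F by split=> //; exists M0.
split.
- by move=> d [M FM Md]; apply: (sub M).
- move=> d e [M FM Md] [M' FM' M'e]; have [h|h] := tot _ _ FM FM'.
    by case: (wc _ FM' d e (h _ Md) M'e) => ?; [left|right]; exists M'.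
  by case: (wc _ FM d e Md (h _ M'e)) => ?; [left|right]; exists M.
- by move=> y Py; apply: unionP => // M /Fg[_ _ h _]; apply: h.
- by move=> u Lu; apply: unionL => // M /Fg[_ _ _ h]; apply: h.
Qed.

(** The elements of [L] that act trivially can always be adjoined, so a maximal
    [M] contains them; [M] is then determined by its image among operators. *)
Let good_kernel M : good M -> good (M `|` (L `&` Z)).
Proof.
move=> [ML Mw MP MA]; split.
- by move=> d [/ML//|[]].
- move=> d e [Md|[Ld Zd]] [Me|[Le Ze]].
  + by case: (Mw _ _ Md Me); [left|right]; left.
  + by left; right; split; [apply: Lcomm => //; apply: ML|apply: comm_zr => //; apply: ML].
  + by left; right; split; [apply: Lcomm => //; apply: ML|apply: comm_zl => //; apply: ML].
  + by left; right; split; [apply: Lcomm|apply: comm_zl].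
- move=> y Py; move: (Py); elim: (MP y Py) => [w Qw _|w _ ih Pw]; first exact: tnil_base.
  apply: tnil_step => m [Mm|[Lm Zm]]; last by apply/tnil_base/Zm.
  by apply: ih => //; apply: LP => //; apply: ML.
- move=> u Lu; move: (Lu); elim: (MA u Lu) => [w Zw _|w _ ih Lw]; first exact: tnil_base.
  apply: tnil_step => m [Mm|[Lm Zm]]; last by apply/tnil_base/comm_zl.
  by apply: ih => //; apply: Lcomm => //; apply: ML.
Qed.

Let good_extend M e : good M -> L `&` Z `<=` M -> L e ->
  (forall m, M m -> M (comm m e)) -> good (M `|` [set e]).
Proof.
move=> [ML Mw MP MA] ZM Le Me.
have M'L d : (M `|` [set e]) d -> L d by move=> [/ML//|->].
split=> //.
- move=> d d' [Md|->] [Md'|->].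
  + by case: (Mw _ _ Md Md'); [left|right]; left.
  + by left; left; apply: Me.
  + by right; left; apply: Me.
  + left; left; apply: ZM; split; first exact: Lcomm.
    by move=> y Py; rewrite /comm subrr.
- pose S := [set y | tnil app (M `|` [set e]) Q y].
  have Sact m y : (M `|` [set e]) m -> S y -> S (m y).
    move=> Mm; apply: (tnil_act (act := app)) => // m' w /M'L Lm'; exact: LQ.
  apply: (@engel_step _ _ app M e Q P S) => //.
  + by move=> j u /ML Lj; apply: LP.
  + by move=> u; apply: LP.
  + by move=> y Qy; apply: tnil_base.
  + by move=> u /(Lnil Le)[k hk]; exists k; apply: tnil_base.
  + move=> u Pu hu j Mj; rewrite /app.
    have -> : j (e u) = e (j u) + comm j e u by rewrite /comm addrC subrK.
    apply: (tnil_add (act := app)) => //; first by move=> m /M'L/Ladd.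
    * by move=> m w /M'L; apply: LQ.
    * by apply: Sact; [right|apply: hu].
    * by apply: (hu (comm j e)); apply: Me.
  + by move=> u Pu hu he; apply: tnil_step => m [/hu//|->].
- pose S := [set u | tnil comm (M `|` [set e]) Z u].
  have Sact m u : (M `|` [set e]) m -> S u -> S (comm m u).
    by move=> Mm; apply: (tnil_act (act := comm)) => // m' w /M'L; apply: comm_zr.
  apply: (@engel_step _ _ comm M e Z L S) => //.
  + by move=> j u /ML Lj; apply: Lcomm.
  + by move=> u; apply: Lcomm.
  + by move=> u Zu; apply: tnil_base.
  + by move=> u Lu; have [k hk] := ad_nil Le Lu; exists k; apply: tnil_base.
  + move=> u Lu hu j Mj.
    have Lj := ML _ Mj.
    have -> : comm j (comm e u) = comm e (comm j u) + comm (comm j e) u.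
      apply/funext => y; rewrite [RHS]/GRing.add /= /comm.
      rewrite !(additive_mapB _ _ (Ladd Lj)) !(additive_mapB _ _ (Ladd Le)).
      rewrite !(additive_mapB _ _ (Ladd Lu)) !opprB.
      rewrite [RHS](AC ((2*2)*(2*2)) ((5*4)*(7*2)*(1*6)*(3*8))).
      by rewrite /= !subrr !addr0.
    apply: (tnil_add (act := comm)) => //.
    * move=> m /M'L Lm x y; apply/funext => w; rewrite [RHS]/GRing.add /= /comm.
      by rewrite [in m _]/GRing.add /= (Ladd Lm) opprD addrACA.
    * by move=> m w /M'L Lm; apply: comm_zr.
    * by move=> x y Zx Zy w Pw; apply: QD; [apply: Zx|apply: Zy].
    * by apply: Sact; [right|apply: hu].
    * by apply: (hu (comm j e)); apply: Me.
  + by move=> u Pu hu he; apply: tnil_step => m [/hu//|->].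
Qed.

(** If a maximal good [M] were smaller than [L], nilpotency of [ad M] on [L] would
    give [e] in [L] outside [M] with [[M, e]] inside [M], and [M] together with
    [e] would be good as well. *)
Theorem engel_zorn y : P y -> tnil app L Q y.
Proof.
move=> Py; have [M [gM maxM]] := Zorn_bigcup good_bigcup.
have ext N : good N -> M `<=` N -> N `<=` M.
  move=> gN MN; apply: contrapT => nNM; exact: (maxM N).
have ZM : L `&` Z `<=` M.
  move=> z hz; apply: (ext _ (good_kernel gM)); [by move=> ?; left|by right].
have [ML Mw MP MA] := gM.
suff LM : L `<=` M by apply: tnil_sub LM (MP y Py).
move=> e0 Le0; apply: contrapT => nMe0.
have [e [Le nMe hMe]] : exists u, [/\ L u, ~ M u & forall m, M m -> M (comm m u)].
  apply: tnil_descent (MA e0 Le0) Le0 nMe0 => [m w /ML Lm|w Lw Zw]; first exact: Lcomm.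
  by apply: ZM; split.
apply: nMe; apply: (ext _ (good_extend gM ZM Le hMe)); [by move=> ?; left|by right].
Qed.
End EngelZorn.
Arguments app {V}.
Arguments comm {V}.

(** * Unions of chains of derivations of a field *)

Lemma additive_map_sum (V W : zmodType) (d : V -> W) (I : Type) (r : seq I) (f : I -> V) :
  additive_map d -> d (\sum_(i <- r) f i) = \sum_(i <- r) d (f i).
Proof. by move=> dD; apply: big_morph => //; apply: additive_map0. Qed.

Section Spans.
Variables (F : fieldType) (vT : vectType F).

Lemma free_spanning_subset (S : set vT) :
  exists X : seq vT, [/\ free X, forall x, x \in X -> S x & forall v, S v -> v \in <<X>>%VS].
Proof.
pose P n := `[< exists X : seq vT, [/\ free X, forall x, x \in X -> S x & size X = n] >].
have P0 : exists n, P n.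
  by exists 0%N; apply/asboolP; exists [::]; split; rewrite ?nil_free.
have Pub n : P n -> (n <= \dim (fullv : {vspace vT}))%N.
  move=> /asboolP[X [fX _ <-]].
  by move: fX; rewrite /free => /eqP <-; apply: dimvS; apply: subvf.
case: (ex_maxnP P0 Pub) => n /asboolP[X [fX XS <-]] maxX.
exists X; split=> // v Sv; apply: contrapT => /negP nv.
suff : (size (v :: X) <= size X)%N by rewrite /= ltnn.
apply: maxX; apply/asboolP; exists (v :: X); split=> //.
  by rewrite free_cons nv.
by move=> x; rewrite inE => /orP[/eqP->|/XS].
Qed.

(** The sets [Y i] are spaces over a subfield of constants only, so dimensions over
    [F] decide the chain because of the third hypothesis: inside the chain the
    coordinates of a vector are constants. *)
Lemma chain_stabilizes (J : Type) (D : set J) (Y : J -> set vT) :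
    D !=set0 -> (forall i j, D i -> D j -> Y i `<=` Y j \/ Y j `<=` Y i) ->
    (forall i j (X : seq vT) v, D i -> D j -> free X -> (forall x, x \in X -> Y j x) ->
      Y i v -> v \in <<X>>%VS -> Y j v) ->
  exists2 i, D i & forall j, D j -> Y i `<=` Y j.
Proof.
move=> [i0 Di0] tot hspan.
pose B i (X : seq vT) := [/\ free X, forall x, x \in X -> Y i x &
  forall v, Y i v -> v \in <<X>>%VS].
pose P n := `[< exists i X, [/\ D i, B i X & size X = n] >].
have P0 : exists n, P n.
  have [X BX] := free_spanning_subset (Y i0).
  by exists (size X); apply/asboolP; exists i0, X.
case: (ex_minnP P0) => n /asboolP[i [X [Di [fX XY XS] <-]]] minX.
exists i => // j Dj; have [//|ji] := tot i j Di Dj.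
have [X' [fX' XY' XS']] := free_spanning_subset (Y j).
have le : (size X <= size X')%N.
  by apply: minX; apply/asboolP; exists j, X'; split.
move=> v Yv; apply: (hspan i j X') => //.
have sub : (<<X'>> <= <<X>>)%VS.
  by apply/span_subvP => x /XY' /ji /XS.
have /eqP -> : <<X'>>%VS == <<X>>%VS.
  rewrite eqEdim sub /=; move: fX fX'; rewrite /free => /eqP -> /eqP ->.
  exact: le.
exact: XS.
Qed.

End Spans.

Section LinearSpan.
Variable F : fieldType.
Implicit Types (C : set F) (M : set (F -> F)) (d s t : F -> F).

(** Coefficients in a set [C], to treat combinations with constant coefficients
    and combinations over the whole field at the same time. *)
Inductive lspan C M : set (F -> F) :=
| lspan0 : lspan C M (fun=> 0)
| lspanS c d s of C c & M d & lspan C M s : lspan C M (fun x => c * d x + s x).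

Lemma lspanD C M s t : lspan C M s -> lspan C M t -> lspan C M (fun x => s x + t x).
Proof.
elim=> [|c d {}s Cc Md _ ih] ht.
  by rewrite [X in lspan C M X](_ : _ = t) //; apply/funext => x; rewrite add0r.
have := lspanS Cc Md (ih ht); congr lspan.
by apply/funext => x; rewrite addrA.
Qed.

Lemma lspanZ C M c s : (forall a b, C a -> C b -> C (a * b)) -> C c ->
  lspan C M s -> lspan C M (fun x => c * s x).
Proof.
move=> CM Cc; elim=> [|b d {}s Cb Md _ ih].
  by rewrite [X in lspan C M X](_ : _ = fun=> 0);
    [exact: lspan0|apply/funext => x; rewrite mulr0].
have := lspanS (CM _ _ Cc Cb) Md ih; congr lspan.
by apply/funext => x; rewrite mulrDr mulrA.
Qed.

Lemma lspan_gen C M d : C 1 -> M d -> lspan C M d.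
Proof.
move=> C1 Md; have := lspanS C1 Md (lspan0 C M); congr lspan.
by apply/funext => x; rewrite mul1r addr0.
Qed.

Lemma lspan_sub C C' M M' : C `<=` C' -> M `<=` M' -> lspan C M `<=` lspan C' M'.
Proof.
move=> CC MM s; elim=> [|c d {}s /CC Cc /MM Md _ ih]; first exact: lspan0.
exact: lspanS.
Qed.

Lemma lspan_idem C M : lspan setT (lspan C M) `<=` lspan setT M.
Proof.
move=> s; elim=> [|c d {}s _ Md _ ih]; first exact: lspan0.
apply: lspanD => //; apply: lspanZ => //.
exact: lspan_sub Md.
Qed.

Definition deriv d := additive_map d /\ leibniz d.

Lemma lspan_deriv C M s : (forall d, M d -> deriv d) -> lspan C M s -> deriv s.
Proof.
move=> hM; elim=> [|c d {}s Cc /hM[dD dM] _ [sD sM]]; split=> x y /=.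
- by rewrite addr0.
- by rewrite mul0r mulr0 addr0.
- by rewrite dD sD mulrDr addrACA.
- by rewrite dM sM !mulrDr !mulrDl addrACA !mulrA [c * x]mulrC.
Qed.

Lemma deriv1 d : deriv d -> d 1 = 0.
Proof. by move=> [_]; apply: leibniz1. Qed.

Lemma deriv_inv d c : deriv d -> d c = 0 -> d c^-1 = 0.
Proof.
move=> hd dc; have [->|c0] := eqVneq c 0; first by rewrite invr0 additive_map0 //; case: hd.
have := hd.2 c c^-1; rewrite mulfV // deriv1 // dc mul0r add0r => /esym/eqP.
by rewrite mulf_eq0 (negPf c0) => /eqP.
Qed.

Section Ev.
Variables (n : nat) (z : 'I_n -> F).
Definition evz d : 'rV[F]_n := \row_i d (z i).

Lemma lspan_evz M (X : seq 'rV[F]_n) v : (forall x, x \in X -> exists2 d, M d & x = evz d) ->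
  v \in <<X>>%VS -> exists2 s, lspan setT M s & v = evz s.
Proof.
elim: X v => [|x X ih] v hX.
  rewrite span_nil memv0 => /eqP ->; exists (fun=> 0); first exact: lspan0.
  by apply/rowP => i; rewrite !mxE.
have {}ih := ih _ (fun y yX => hX y (mem_behead (s := x :: X) yX)).
rewrite span_cons => /memv_addP[_ /vlineP[k ->] [w /ih[s hs ->] ->]].
have [d Md ->] := hX x (mem_head _ _).
exists (fun y => k * d y + s y); first exact: lspanS.
by apply/rowP => i; rewrite !mxE.
Qed.
End Ev.

Section UnionField.
Variables (n : nat) (z : 'I_n -> F).

Definition null : set F := [set 0].

Lemma finite_in_chain (T : Type) (Fam : set (set T)) k (f : 'I_k -> T) :
    Fam !=set0 -> total_on Fam subset -> (forall i, (\bigcup_(M in Fam) M) (f i)) ->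
  exists2 M, Fam M & forall i, M (f i).
Proof.
move=> [M0 FM0] tot; elim: k f => [|k ih] f hf; first by exists M0 => // -[].
have [M FM hM] := ih (fun i => f (lift ord0 i)) (fun i => hf _).
have [M' FM' hM'] := hf ord0.
have h i : M (f i) \/ M' (f i).
  by case: (unliftP ord0 i) => [j ->|->]; [left|right].
have [s|s] := tot _ _ FM FM'.
  by exists M' => // i; case: (h i) => [/s|].
by exists M => // i; case: (h i) => [|/s].
Qed.

(** Constants pass through the bracket, so weak closure of [M] becomes genuine
    closure for combinations with constant coefficients. *)
Lemma lspan_comm C M s t : (forall d, M d -> deriv d) -> weakly_closed M ->
    (forall a b, C a -> C b -> C (a * b)) -> C (-1) ->
    (forall d c, M d -> C c -> d c = 0) ->
  lspan C M s -> lspan C M t -> lspan C M (comm s t).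
Proof.
move=> hM wc CM CN1 MC hs ht.
have C1 : C 1 by have := CM _ _ CN1 CN1; rewrite mulrNN mulr1.
have base d e : M d -> M e -> lspan C M (comm d e).
  move=> Md Me; case: (wc _ _ Md Me) => h; first exact: lspan_gen.
  have := lspanZ CM CN1 (lspan_gen C1 h); congr lspan.
  by apply/funext => x; rewrite mulN1r /comm opprB.
have dt u : lspan C M u -> deriv u by apply: lspan_deriv.
have left_ d : M d -> lspan C M (comm d t).
  move=> Md; elim: ht => [|c e {t hs} t Cc Me _ ih].
    rewrite [X in lspan C M X](_ : _ = fun=> 0); first exact: lspan0.
    by apply/funext => x; rewrite /comm subr0 additive_map0 //; case: (hM _ Md).
  have := lspanD (lspanZ CM Cc (base _ _ Md Me)) ih; congr lspan.
  apply/funext => x; rewrite /comm; have [dD dM] := hM _ Md.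
  by rewrite dD dM (MC _ _ Md Cc) mul0r add0r mulrBr opprD addrACA.
elim: hs => [|c d {}s Cc Md hs ih].
  rewrite [X in lspan C M X](_ : _ = fun=> 0); first exact: lspan0.
  by apply/funext => x; rewrite /comm sub0r additive_map0 ?oppr0 //; case: (dt _ ht).
have := lspanD (lspanZ CM Cc (left_ _ Md)) ih; congr lspan.
apply/funext => x; rewrite /comm; have [tD tM] := dt _ ht.
have tc : t c = 0.
  elim: (ht) => // b e {}u _ Me _ ->; by rewrite (MC _ _ Me Cc) mulr0 addr0.
by rewrite tD tM tc mul0r add0r mulrBr opprD addrACA.
Qed.

Lemma tnil_lspan C M f : (forall d, M d -> additive_map d) ->
    (forall d c x, M d -> C c -> d (c * x) = c * d x) ->
  tnil app M null f -> tnil app (lspan C M) null f.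
Proof.
move=> hM MC; elim=> [w w0|w _ ih]; first exact: tnil_base.
have hS d : lspan C M d -> additive_map d.
  elim=> [x y|c e s _ Me _ hs x y] /=; first by rewrite addr0.
  by rewrite (hM _ Me) hs mulrDr addrACA.
have null_st m v : lspan C M m -> null v -> null (app m v).
  by move=> hm ->; rewrite /app /null /= additive_map0 //; apply: hS.
apply: tnil_step => s; elim=> [|c d {}s Cc Md _ ih']; first exact: tnil_base.
apply: (tnil_add (u := c * d w)) => //.
  by move=> x y -> ->; rewrite /null /= addr0.
apply: (tnil_sim (R := fun v v' => v' = c * v)) (ih _ Md) _ => [v v' -> ->|v v' m -> hm|//].
  by rewrite /null /= mulr0.
exists m => //; rewrite /app; elim: hm => [|b e t _ Me _ /= ->]; first by rewrite mulr0.
by rewrite (MC e c v Me Cc) mulrDr mulrCA.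
Qed.

Definition constants (L : set (F -> F)) : set F := [set c | forall d, L d -> d c = 0].

Lemma constantsM L a b : (forall d, L d -> deriv d) ->
  constants L a -> constants L b -> constants L (a * b).
Proof.
by move=> hL Ca Cb d Ld; rewrite (hL _ Ld).2 (Ca d Ld) (Cb d Ld) mul0r mulr0 addr0.
Qed.

Lemma constantsB L a b : (forall d, L d -> deriv d) ->
  constants L a -> constants L b -> constants L (a - b).
Proof.
by move=> hL Ca Cb d Ld; rewrite additive_mapB ?(Ca d Ld) ?(Cb d Ld) ?subr0 //; case: (hL _ Ld).
Qed.

(** The derivations in [L] form a space of finite rank over [F], as they are
    determined by their values at [z].  A member of the chain that contains a
    basis of that space has the same constants as [L]. *)
Lemma constants_chain (Fam : set (set (F -> F))) (L := \bigcup_(M in Fam) M) :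
    Fam !=set0 -> total_on Fam subset -> (forall d, L d -> deriv d) ->
    (forall s, lspan setT L s -> (forall i, s (z i) = 0) -> forall x, s x = 0) ->
  exists2 M0, Fam M0 & exists k (ds : 'I_k -> F -> F),
    (forall i, M0 (ds i)) /\ forall c, (forall i, ds i c = 0) -> constants L c.
Proof.
move=> ne tot hL det.
have [X [_ XL XS]] := free_spanning_subset [set v | exists2 d, L d & v = evz z d].
have ds0 (i : 'I_(size X)) : exists d, L d /\ X`_i = evz z d.
  by have [d Ld e] := XL _ (mem_nth 0 (ltn_ord i)); exists d.
have [ds hds] := choice ds0.
have [M0 FM0 M0ds] := finite_in_chain ne tot (fun i => (hds i).1).
exists M0 => //; exists (size X), ds; split=> // c hc d Ld.
have [s hs es] : exists2 s, lspan setT [set d | exists i, d = ds i] s & evz z d = evz z s.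
  apply: (@lspan_evz n z _ X) => [x xX|]; last by apply: XS; exists d.
  have ix : (index x X < size X)%N by rewrite index_mem.
  exists (ds (Ordinal ix)); first by exists (Ordinal ix).
  by rewrite -(hds _).2 nth_index.
have sub : [set d | exists i, d = ds i] `<=` L by move=> _ [i ->]; exact: (hds i).1.
have dsE : d c + -1 * s c = 0.
  apply: (det (fun x => d x + -1 * s x)).
    apply: lspanD; first exact: lspan_gen.
    by apply: lspanZ => //; apply: lspan_sub hs.
  move=> i; have := congr1 (fun v : 'rV_n => v 0 i) es; rewrite !mxE => ->.
  by rewrite mulN1r subrr.
have sc : s c = 0 by elim: hs => // a _ t _ [i ->] _ ->; rewrite hc mulr0 addr0.
by move: dsE; rewrite sc mulr0 addr0.
Qed.

(** Apply [D] to the expansion of [v] in [X]: invariant vectors that are dependent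
    over the field are already dependent over the constants. *)
Lemma free_coord_const (vT : vectType F) (X : seq vT) v (d : F -> F) (D : vT -> vT) :
    additive_map D -> (forall c w, D (c *: w) = d c *: w + c *: D w) ->
    free X -> v \in <<X>>%VS -> D v = 0 -> (forall x, x \in X -> D x = 0) ->
  forall i, d (coord (in_tuple X) i v) = 0.
Proof.
move=> DD DZ fX vX Dv DX.
have := Dv; rewrite {1}(coord_span (X := in_tuple _) vX) additive_map_sum // => h.
have {}h : \sum_i d (coord (in_tuple X) i v) *: (in_tuple X)`_i = 0.
  apply: etrans h; apply: eq_bigr => i _; rewrite DZ DX ?scaler0 ?addr0 //.
  by rewrite mem_nth.
have /freeP fX' : free (in_tuple X) by [].
exact: (fX' (fun i => d (coord (in_tuple X) i v)) h).
Qed.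

(** Induction on the rank of [L] over [F].  Some [x] which is not a constant is
    mapped to constants by all of [L]: each member of the chain has such
    elements by [tnil_descent], their derivatives span spaces of bounded
    dimension over the constants, and these stabilize.  The combinations with
    constant coefficients that annihilate [x] have smaller rank, hence act
    nilpotently by induction, and one further derivation [e] with [e x <> 0]
    completes them to [L], since [d x / e x] is a constant for all [d] in [L];
    [engel_step] concludes. *)
Lemma union_field r (Fam : set (set (F -> F))) (L := \bigcup_(M in Fam) M)
    (U : {vspace 'rV[F]_n}) :
    Fam !=set0 -> total_on Fam subset -> (forall M, Fam M -> weakly_closed M) ->
    (forall d, L d -> deriv d) ->
    (forall s, lspan setT L s -> (forall i, s (z i) = 0) -> forall x, s x = 0) ->
    (\dim U < r)%N -> (forall d, L d -> evz z d \in U) ->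
  forall f, (forall M, Fam M -> tnil app M null f) -> tnil app L null f.
Proof.
elim: r Fam @L U => [//|r ih] Fam L U ne tot wc hL det dimU evU.
pose F0 : set F := [set f | forall M, Fam M -> tnil app M null f].
pose S : set F := [set f | tnil app L null f].
pose C := constants L.
have ML M : Fam M -> M `<=` L by move=> FM d Md; exists M.
have addL d : L d -> additive_map d by move=> /hL[].
have CM a b : C a -> C b -> C (a * b) by apply: constantsM.
have CB a b : C a -> C b -> C (a - b) by apply: constantsB.
have C0 : C 0 by move=> d /addL/additive_map0.
have C1 : C 1 by move=> d /hL/deriv1.
have CN1 : C (-1) by rewrite -sub0r; apply: CB.
have CD a b : C a -> C b -> C (a + b).
  by move=> Ca Cb; rewrite -[b]opprK; apply: (CB) => //; rewrite -sub0r; apply: (CB).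
have CV a : C a -> C a^-1 by move=> Ca d Ld; apply: deriv_inv; [apply: hL|apply: Ca].
have LZ d c x : L d -> C c -> d (c * x) = c * d x.
  by move=> Ld Cc; rewrite (hL _ Ld).2 (Cc d Ld) mul0r add0r.
have null_st (K : set (F -> F)) m v : K `<=` L -> K m -> null v -> null (app m v).
  by move=> KL /KL/addL hm ->; rewrite /app /null /= additive_map0.
have nullD (x y : F) : null x -> null y -> null (x + y).
  by move=> -> ->; rewrite /null /= addr0.
have tD (K : set (F -> F)) x y : K `<=` L -> tnil app K null x -> tnil app K null y ->
    tnil app K null (x + y).
  move=> KL; apply: tnil_add => //; first by move=> m /KL/addL.
  by move=> m w; apply: null_st.
have tZ (K : set (F -> F)) c x : K `<=` L -> C c -> tnil app K null x ->
    tnil app K null (c * x).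
  move=> KL Cc tx; apply: (tnil_sim (R := fun v v' => v' = c * v)) tx erefl.
    by move=> v v' -> ->; rewrite /null /= mulr0.
  by move=> v v' m -> Km; exists m => //; rewrite /app LZ //; apply: KL.
have F0D x y : F0 x -> F0 y -> F0 (x + y).
  by move=> hx hy M FM; apply: tD; [apply: ML|apply: hx|apply: hy].
have F0Z c x : C c -> F0 x -> F0 (c * x).
  by move=> Cc hx M FM; apply: tZ => //; [apply: ML|apply: hx].
have F0L d x : L d -> F0 x -> F0 (d x).
  move=> [M FM Md] hx M' FM'; have [s|s] := tot _ _ FM FM'.
    apply: (tnil_act (act := app)) (s _ Md) (hx _ FM') => m w.
    by apply: null_st; apply: ML.
  apply: tnil_sub s _; apply: (tnil_act (act := app)) Md (hx _ FM) => m w.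
  by apply: null_st; apply: ML.
have CS : C `<=` S.
  by move=> c Cc; apply: tnil_step => m Lm; apply: tnil_base; exact: Cc.
have [F0C|] := pselect (F0 `<=` C); first by move=> f /F0C/CS.
move=> /existsNP[f0 /not_implyP[F0f0 nCf0]].
have [M0 FM0 [k [ds [M0ds dsC]]]] := constants_chain ne tot hL det.
pose D : set (set (F -> F)) := [set M | Fam M /\ M0 `<=` M].
pose X M : set F := [set x | F0 x /\ forall m, M m -> C (m x)].
pose row x : 'rV[F]_k := \row_i ds i x.
pose Y M : set 'rV[F]_k := [set v | exists2 x, X M x & v = row x].
have XZ M c x : Fam M -> C c -> X M x -> X M (c * x).
  move=> FM Cc [F0x hx]; split; first exact: F0Z.
  by move=> m Mm; rewrite LZ //; [apply: CM => //; apply: hx|apply: ML Mm].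
have XD M x y : Fam M -> X M x -> X M y -> X M (x + y).
  move=> FM [F0x hx] [F0y hy]; split; first exact: F0D.
  move=> m Mm; rewrite addL; last exact: ML Mm.
  by apply: CD; [apply: hx|apply: hy].
have Lds i : L (ds i) by apply: ML (M0ds i).
have rowD x y : row (x + y) = row x + row y.
  by apply/rowP => i; rewrite !mxE addL.
have rowZ c x : C c -> row (c * x) = c *: row x.
  by move=> Cc; apply/rowP => i; rewrite !mxE LZ.
have [M1 [FM1 M01] Ymin] : exists2 M1, D M1 & forall M, D M -> Y M1 `<=` Y M.
  apply: chain_stabilizes.
  - by exists M0; split.
  - have sub M M' : M `<=` M' -> Y M' `<=` Y M.
      by move=> s v [x [F0x hx] ->]; exists x => //; split=> // m /s; apply: hx.
    move=> M M' [FM _] [FM' _]; have [s|s] := tot _ _ FM FM'.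
      by right; apply: sub.
    by left; apply: sub.
  - move=> M M' Xs v [FM M0M] [FM' M0M'] fXs XsY [x [F0x hx] ->] vX.
    have Cco i : C (coord (in_tuple Xs) i (row x)).
      apply: dsC => j; have hj := hL _ (Lds j).
      apply: (free_coord_const (D := map_mx (ds j))) fXs vX _ _ i.
      + by move=> a b; apply/rowP => l; rewrite !mxE hj.1.
      + by move=> a b; apply/rowP => l; rewrite !mxE hj.2.
      + by apply/rowP => l; rewrite !mxE; apply: (hx _ (M0M _ (M0ds l))).
      + move=> _ /XsY[y [F0y hy] ->].
        by apply/rowP => l; rewrite !mxE; apply: (hy _ (M0M' _ (M0ds l))).
    have ys0 (i : 'I_(size Xs)) : exists y, X M' y /\ Xs`_i = row y.
      by have [y] := XsY _ (mem_nth 0 (ltn_ord i)); exists y.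
    have [ys hys] := choice ys0.
    exists (\sum_i coord (in_tuple Xs) i (row x) * ys i).
      apply: (big_ind (X M')) => [|a b|i _]; [|exact: XD|].
        split=> [M'' FM''|m Mm]; first exact: tnil_base.
        by rewrite (additive_map0 (addL _ (ML _ FM' _ Mm))).
      by apply: XZ => //; apply: (hys i).1.
    rewrite {1}(coord_span (X := in_tuple _) vX) (big_morph row rowD (id1 := 0)); last first.
      by apply/rowP => i; rewrite !mxE additive_map0 //; apply: addL.
    by apply: eq_bigr => i _; rewrite rowZ //= (hys i).2.
(* Equality of the rows of [x] and [x'] means that [x - x'] is a constant, so [x]
   inherits from [x'] the property for each member of the chain. *)
have [x [F0x nCx LxC]] : exists x, [/\ F0 x, ~ C x & forall d, L d -> C (d x)].
  have [x [F0x nCx M1x]] : exists x, [/\ F0 x, ~ C x & forall m, M1 m -> C (app m x)].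
    apply: tnil_descent (F0f0 _ FM1) F0f0 nCf0 => [m w M1m|w _ ->//].
    by apply: F0L; apply: ML M1m.
  exists x; split=> // d [M FM Md].
  have [M' DM' M'd] : exists2 M', D M' & M' d.
    by have [s|s] := tot _ _ FM0 FM; [exists M|exists M0 => //; [split|apply: s]].
  have [x' [_ hx'] xx'] : Y M' (row x) by apply: Ymin DM' _ _; exists x.
  have : C (x - x').
    apply: dsC => i; rewrite additive_mapB; last exact: addL.
    by have := congr1 (fun v : 'rV_k => v 0 i) xx'; rewrite !mxE => ->; rewrite subrr.
  move=> /(_ d (ML _ FM _ Md)); rewrite additive_mapB; last by apply/addL/(ML _ FM).
  by move=> /subr0_eq ->; apply: hx'.
have [e Le ex0] : exists2 e, L e & e x <> 0.
  apply: contrapT => h; apply: nCx => d Ld; apply: contrapT => dx.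
  by apply: h; exists d.
have Cex : C (e x) by exact: LxC.
(* Constant coefficients keep [J M] nilpotent on [F0]; coefficients in [F] would
   not. *)
pose J M : set (F -> F) := [set s | lspan C M s /\ s x = 0].
pose Fam' : set (set (F -> F)) := [set J M | M in Fam].
pose L' := \bigcup_(M in Fam') M.
have lsub M M' : M `<=` M' -> lspan C M `<=` lspan C M' by apply: lspan_sub.
have L'E s : L' s <-> exists2 M, Fam M & J M s.
  split=> [[_ [M FM <-] Js]|[M FM Js]]; first by exists M.
  by exists (J M) => //; exists M.
have L'L : L' `<=` lspan C L.
  by move=> s /L'E[M FM [hs _]]; apply: lsub hs; apply: ML.
have dL' s : L' s -> deriv s by move=> /L'L; apply: lspan_deriv.
have killC M d c : Fam M -> M d -> C c -> d c = 0.
  by move=> FM Md; apply; apply: ML Md.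
have ih' f : F0 f -> tnil app L' null f.
  move=> F0f.
  have [B [_ BL' BS]] := free_spanning_subset [set v | exists2 d, L' d & v = evz z d].
  apply: (ih Fam' <<B>>%VS) => //.
  - by have [M FM] := ne; exists (J M); exists M.
  - move=> _ _ [M FM <-] [M' FM' <-]; have [s|s] := tot _ _ FM FM'.
      by left=> t [ht tx]; split=> //; apply: lsub ht.
    by right=> t [ht tx]; split=> //; apply: lsub ht.
  - move=> _ [M FM <-] s t [hs sx] [ht tx]; left; split.
      apply: lspan_comm hs ht => //; first by move=> d /(ML _ FM)/hL.
        exact: wc.
      by move=> d c; apply: killC FM.
    have hM d : M d -> deriv d by move=> /(ML _ FM)/hL.
    rewrite /comm sx tx (additive_map0 (lspan_deriv hM hs).1).
    by rewrite (additive_map0 (lspan_deriv hM ht).1) subrr.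
  - move=> s hs; apply: det; apply: (lspan_idem (C := C)).
    by apply: lspan_sub hs => // t /L'L; apply: lspan_sub.
  - apply: (@leq_trans (\dim U)); last by [].
    have evL' s : L' s -> evz z s \in U.
      move=> /L'L; elim=> [|c d {}s _ Ld _ hs].
        rewrite [evz z _](_ : _ = 0) ?mem0v //.
        by apply/rowP => i; rewrite !mxE.
      rewrite [evz z _](_ : _ = c *: evz z d + evz z s).
        by apply: memvD => //; apply/memvZ/evU.
      by apply/rowP => i; rewrite !mxE.
    have BU : (<<B>> <= U)%VS by apply/span_subvP => v /BL'[s /evL' ? ->].
    rewrite ltnNge; apply/negP => le.
    have /eqP BUe : (<<B>>%VS == U) by rewrite eqEdim BU.
    have : evz z e \in <<B>>%VS by rewrite BUe evU.
    move=> /(lspan_evz BL')[s hs es].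
    have sx : s x = 0.
      elim: hs => // a d t _ /L'E[M _ [_ ->]] _ ->; by rewrite mulr0 addr0.
    have : e x + -1 * s x = 0.
      apply: (det (fun x => e x + -1 * s x)).
        apply: lspanD; first exact: lspan_gen.
        apply: lspanZ => //; apply: (lspan_idem (C := C)).
        by apply: lspan_sub hs => // t /L'L; apply: lspan_sub.
      move=> i; have := congr1 (fun v : 'rV_n => v 0 i) es; rewrite !mxE => ->.
      by rewrite mulN1r subrr.
    by rewrite sx mulr0 addr0.
  - by move=> d L'd; apply: BS; exists d.
  - move=> _ [M FM <-]; apply: (tnil_sub (M := lspan C M)); first by move=> s [].
    apply: tnil_lspan (F0f _ FM); first by move=> d /(ML _ FM)/addL.
    by move=> d c y /(ML _ FM); apply: LZ.
have F0L' s u : L' s -> F0 u -> F0 (s u).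
  move=> /L'L; elim=> [_ M _|c d {}s Cc Ld _ hs hu]; first exact: tnil_base.
  by apply: F0D; [apply/F0Z/F0L|apply: hs].
suff : F0 `<=` S by apply.
apply: (@engel_step _ _ app L' e null F0 S) => //.
- by move=> u; apply: F0L.
- by move=> u hu; apply: tnil_base.
- move=> u F0u; have [M FM Me] := Le.
  have [j hj] : exists j, null (iter j (app e) u).
    by apply: tnil_iter Me (F0u _ FM) => w; apply: (null_st L).
  by exists j; apply: tnil_base.
- move=> u F0u hu j L'j; rewrite /app.
  have -> : j (e u) = e (j u) + comm j e u by rewrite /comm addrC subrK.
  apply: tD => //.
    apply: (tnil_act (act := app)) Le (hu _ L'j) => m w; exact: (null_st L).
  apply: (hu (comm j e)); have /L'E[M FM [hj jx]] := L'j; have [M' FM' M'e] := Le.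
  have cm M2 : Fam M2 -> lspan C M2 j -> M2 e -> L' (comm j e).
    move=> FM2 hj2 M2e; apply/L'E; exists M2 => //; split.
      apply: lspan_comm hj2 (lspan_gen C1 M2e) => //; first by move=> d /(ML _ FM2)/hL.
        exact: wc.
      by move=> d c; apply: killC FM2.
    have jC : j (e x) = 0.
      elim: hj2 => // a d t _ Md _ ->; by rewrite (killC M2 d (e x)) // mulr0 addr0.
    by rewrite /comm jC jx (additive_map0 (addL _ Le)) subrr.
  have [s|s] := tot _ _ FM FM'; first by apply: (cm M') => //; apply: lsub hj.
  by apply: (cm M) => //; apply: s.
- move=> u F0u hu Seu; apply: tnil_step => d Ld.
  pose c := d x / e x.
  have Cc : C c by apply: CM; [apply: LxC|apply: CV].
  have -> : app d u = (d u + (- c) * e u) + c * e u by rewrite mulNr subrK.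
  apply: tD => //; last by apply: tZ.
  apply: (hu (fun y => d y + (- c) * e y)); apply/L'E.
  have [M FM hM] : exists2 M, Fam M & M d /\ M e.
    have [M FM Md] := Ld; have [M' FM' M'e] := Le; have [s|s] := tot _ _ FM FM'.
      by exists M' => //; split=> //; apply: s.
    by exists M => //; split=> //; apply: s.
  exists M => //; split.
    apply: lspanD; first by apply: lspan_gen => //; case: hM.
    apply: lspanZ => //; first by rewrite -sub0r; apply: CB.
    by apply: lspan_gen => //; case: hM.
  by rewrite mulNr /c divfK ?subrr //; apply/eqP.
Qed.

End UnionField.
End LinearSpan.
Arguments null {F}.

(** * Unions of chains of semilinear maps *)

(** The index type [I] acts on [F] by [delta] and on the module [N] by the
    semilinear maps [D].  Only the submodule [K] is finite dimensional, modulo the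
    kernel [B0] of the evaluation [ev]; this form covers both vectors and
    derivations, the latter being functions known by finitely many values. *)
Section UnionModule.
Variables (F : fieldType) (n : nat) (z : 'I_n -> F).
Variables (N : lmodType F) (vT : vectType F) (I : Type).
Variables (delta : I -> F -> F) (D : I -> N -> N).
Variables (Fam : set (set I)) (K : set N) (ev : N -> vT).
Let L := \bigcup_(M in Fam) M.
Hypothesis ne : Fam !=set0.
Hypothesis tot : total_on Fam subset.
Hypothesis wc : forall M, Fam M -> weakly_closed [set delta d | d in M].
Hypothesis ddelta : forall d, L d -> deriv (delta d).
Hypothesis det : forall s, lspan setT [set delta d | d in L] s ->
  (forall i, s (z i) = 0) -> forall x, s x = 0.
Hypothesis DD : forall d, L d -> additive_map (D d).
Hypothesis DZ : forall d f w, L d -> D d (f *: w) = delta d f *: w + f *: D d w.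
Hypothesis K0 : K 0.
Hypothesis KD : forall x y, K x -> K y -> K (x + y).
Hypothesis KZ : forall f x, K x -> K (f *: x).
Hypothesis KL : forall d x, L d -> K x -> K (D d x).
Hypothesis evD : additive_map ev.
Hypothesis evZ : forall f w, ev (f *: w) = f *: ev w.
Let B0 : set N := [set w | K w /\ ev w = 0].
Hypothesis B0L : forall d x, L d -> B0 x -> B0 (D d x).

Let C := constants [set delta d | d in L].
Let N0 : set N := [set w | K w /\ forall M, Fam M -> tnil D M B0 w].
Let S : set N := [set w | tnil D L B0 w].

Let ML M : Fam M -> M `<=` L. Proof. by move=> FM d Md; exists M. Qed.

Let KN x : K x -> K (- x).
Proof. by move=> Kx; rewrite -scaleN1r; apply: KZ. Qed.

Let KB x y : K x -> K y -> K (x - y).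
Proof. by move=> Kx Ky; apply: KD => //; apply: KN. Qed.

Let B0D x y : B0 x -> B0 y -> B0 (x + y).
Proof. by move=> [Kx ex] [Ky ey]; split; [apply: KD|rewrite evD ex ey addr0]. Qed.

Let B0Z f x : B0 x -> B0 (f *: x).
Proof. by move=> [Kx ex]; split; [apply: KZ|rewrite evZ ex scaler0]. Qed.

Let B00 : B0 0.
Proof. by split=> //; apply: additive_map0. Qed.

Let imL : \bigcup_(M in [set [set delta d | d in M] | M in Fam]) M = [set delta d | d in L].
Proof.
apply/seteqP; split=> [s [_ [M FM <-] [d Md <-]]|_ [d [M FM Md] <-]].
  by exists d => //; exists M.
by exists [set delta d | d in M]; [exists M|exists d].
Qed.

Let imtot : total_on [set [set delta d | d in M] | M in Fam] subset.
Proof.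
move=> _ _ [M FM <-] [M' FM' <-].
by have [s|s] := tot FM FM'; [left|right] => _ [d /s Md <-]; exists d.
Qed.

Let imne : [set [set delta d | d in M] | M in Fam] !=set0.
Proof. by have [M FM] := ne; exists [set delta d | d in M]; exists M. Qed.

Let CE c : C c <-> forall d, L d -> delta d c = 0.
Proof.
split=> [h d Ld|h _ [d Ld <-]]; last exact: h.
by apply: h; exists d.
Qed.

Let constants_from : exists2 M0, Fam M0 & forall c, (forall d, M0 d -> delta d c = 0) -> C c.
Proof.
have [||_ [M0 FM0 <-] [k [ds [hds dsC]]]] := constants_chain (z := z) imne imtot.
- by rewrite imL => _ [d Ld <-]; apply: ddelta.
- by rewrite imL; apply: det.
exists M0 => // c hc; rewrite /C -imL; apply: dsC => i.
by have [d Md <-] := hds i; apply: hc.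
Qed.

Let scalars f : (forall M, Fam M -> tnil delta M null f) -> tnil delta L null f.
Proof.
move=> hf.
have h : tnil app [set delta d | d in L] null f.
  rewrite -imL.
  apply: (union_field (z := z) (r := (\dim (fullv : {vspace 'rV[F]_n})).+1)
    (U := fullv)) => //.
  - by move=> _ [M FM <-]; apply: wc.
  - by rewrite imL => _ [d Ld <-]; apply: ddelta.
  - by rewrite imL; apply: det.
  - by move=> *; apply: memvf.
  move=> _ [M FM <-]; apply: (tnil_sim (R := eq)) (hf _ FM) erefl => [v v' <-//|v v' m <-].
  by move=> [d Md <-]; exists d.
apply: (tnil_sim (R := eq)) h erefl => [v v' <-//|v v' d <- Ld].
by exists (delta d) => //; exists d.
Qed.

Let N0D x y : N0 x -> N0 y -> N0 (x + y).
Proof.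
move=> [Kx hx] [Ky hy]; split; first exact: KD.
move=> M FM; apply: tnil_add; [| |exact: B0D|exact: hx|exact: hy].
  by move=> m /(ML FM); apply: DD.
by move=> m w /(ML FM); apply: B0L.
Qed.

Let N0Z c x : C c -> N0 x -> N0 (c *: x).
Proof.
move=> /CE Cc [Kx hx]; split; first exact: KZ.
move=> M FM; apply: (tnil_sim (R := fun v v' => v' = c *: v)) (hx _ FM) erefl.
  by move=> v v' ->; apply: B0Z.
move=> v v' m -> Mm; exists m => //.
by rewrite DZ ?Cc ?scale0r ?add0r //; apply: ML Mm.
Qed.

Let N0L d x : L d -> N0 x -> N0 (D d x).
Proof.
move=> [M FM Md] [Kx hx]; split; first by apply: KL => //; apply: ML Md.
move=> M' FM'; have [s|s] := tot FM FM'.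
  apply: tnil_act (s _ Md) (hx _ FM') => m w.
  by move=> /(ML FM'); apply: B0L.
apply: tnil_sub s _; apply: tnil_act Md (hx _ FM) => m w.
by move=> /(ML FM); apply: B0L.
Qed.

Let flag (E : {vspace vT}) : set N := [set w | K w /\ ev w \in E].

(** Each member [M] of the chain has invariants modulo the flag outside the flag;
    modulo the flag these are spaces over the constants, of dimension at most
    that of [vT], so they stabilize and yield an invariant of the union. *)
Let extend_flag (E : {vspace vT}) :
  (forall d w, L d -> flag E w -> flag E (D d w)) -> ~ (N0 `<=` flag E) ->
  exists2 w, N0 w & ~ flag E w /\ forall d, L d -> flag E (D d w).
Proof.
move=> EL /existsNP[w0 /not_implyP[N0w0 nEw0]].
have [M0 FM0 M0C] := constants_from.
have flagD x y : flag E x -> flag E y -> flag E (x + y).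
  by move=> [Kx ex] [Ky ey]; split; [apply: KD|rewrite evD memvD].
have flagZ f x : flag E x -> flag E (f *: x).
  by move=> [Kx ex]; split; [apply: KZ|rewrite evZ memvZ].
have flagB x y : flag E x -> flag E y -> flag E (x - y).
  by move=> hx hy; apply: flagD => //; rewrite -scaleN1r; apply: flagZ.
pose kap v := v - projv E v.
have kapD : additive_map kap by move=> x y; rewrite /kap linearD opprD addrACA.
have kapZ f x : kap (f *: x) = f *: kap x by rewrite /kap linearZ /= scalerBr.
have kap0 v : kap v = 0 <-> v \in E.
  split=> [/subr0_eq ->|vE]; first exact: memv_proj.
  by rewrite /kap projv_id // subrr.
pose X M : set N := [set w | N0 w /\ forall m, M m -> flag E (D m w)].
pose Y M : set vT := [set v | exists2 w, X M w & v = kap (ev w)].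
pose Fam0 : set (set I) := [set M | Fam M /\ M0 `<=` M].
have XZ M c x : Fam M -> C c -> X M x -> X M (c *: x).
  move=> FM Cc [N0x hx]; split; first exact: N0Z.
  move=> m Mm; rewrite DZ ?(CE c).1 ?scale0r ?add0r //; try exact: ML Mm.
  by apply: flagZ; apply: hx.
have XD M x y : Fam M -> X M x -> X M y -> X M (x + y).
  move=> FM [N0x hx] [N0y hy]; split; first exact: N0D.
  by move=> m Mm; rewrite DD; [apply: flagD; [apply: hx|apply: hy]|apply: ML Mm].
have [M1 [FM1 M01] Ymin] : exists2 M1, Fam0 M1 & forall M, Fam0 M -> Y M1 `<=` Y M.
  apply: chain_stabilizes.
  - by exists M0; split.
  - have sub M M' : M `<=` M' -> Y M' `<=` Y M.
      by move=> s v [w [N0w hw] ->]; exists w => //; split=> // m /s; apply: hw.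
    move=> M M' [FM _] [FM' _]; have [s|s] := tot FM FM'.
      by right; apply: sub.
    by left; apply: sub.
  move=> M M' Xs v [FM M0M] [FM' M0M'] fXs XsY [w [N0w hw] ->] vX.
  have ys0 (i : 'I_(size Xs)) : exists y, X M' y /\ Xs`_i = kap (ev y).
    by have [y] := XsY _ (mem_nth 0 (ltn_ord i)); exists y.
  have [ys hys] := choice ys0.
  pose co i := coord (in_tuple Xs) i (kap (ev w)).
  have kev0 : kap (ev 0) = 0 by rewrite (additive_map0 evD) (additive_map0 kapD).
  have kevD x y : kap (ev (x + y)) = kap (ev x) + kap (ev y) by rewrite evD kapD.
  have wE : kap (ev w) = kap (ev (\sum_i co i *: ys i)).
    rewrite {1}(coord_span (X := in_tuple _) vX).
    rewrite (big_morph (fun w => kap (ev w)) kevD kev0).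
    by apply: eq_bigr => i _; rewrite evZ kapZ /= (hys i).2.
  have Cco i : C (co i).
    apply: M0C => d M0d.
    have Ld : L d := ML FM0 M0d.
    have fl : flag E (w - \sum_i co i *: ys i).
      split; first apply: KB; first by case: N0w.
        by apply: big_ind => // j _; apply: KZ; case: (hys j) => -[[]].
      apply/kap0; rewrite evD kapD wE (additive_mapN _ evD) (additive_mapN _ kapD).
      by rewrite subrr.
    have := EL _ _ Ld fl; rewrite additive_mapB; last exact: DD.
    move=> h; have {h} : flag E (D d (\sum_i co i *: ys i)).
      by have := flagB _ _ (hw _ (M0M _ M0d)) h; rewrite opprB addrC subrK.
    rewrite additive_map_sum; last exact: DD.
    under eq_bigr do rewrite DZ //.
    rewrite big_split /= => h.
    have : flag E (\sum_i delta d (co i) *: ys i).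
      rewrite -[X in flag E X](addrK (\sum_i co i *: D d (ys i))).
      apply: flagB => //; apply: big_ind => // [|j _].
        by split=> //; rewrite (additive_map0 evD) mem0v.
      by apply: flagZ; apply: (hys j).1.2; apply: M0M'.
    move=> [_ /kap0]; rewrite (big_morph (fun w => kap (ev w)) kevD kev0) => h0.
    have /freeP fXs' : free (in_tuple Xs) by [].
    apply: (fXs' (fun i => delta d (co i))).
    apply: etrans h0; apply: eq_bigr => j _.
    by rewrite evZ kapZ /= (hys j).2.
  exists (\sum_i co i *: ys i) => //.
  apply: (big_ind (X M')) => [|a b|i _]; [|exact: XD|].
    split=> [|m Mm]; first by split=> // M'' FM''; apply: tnil_base.
    rewrite additive_map0; last by apply: DD; apply: ML Mm.
    by split=> //; rewrite (additive_map0 evD) mem0v.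
  by apply: XZ => //; apply: (hys i).1.
have [w [N0w nEw M1w]] : exists w, [/\ N0 w, ~ flag E w & forall m, M1 m -> flag E (D m w)].
  apply: tnil_descent (N0w0.2 _ FM1) N0w0 nEw0 => [m w M1m|w [Kw _] [_ ew]].
    by apply: N0L; apply: ML M1m.
  by split=> //; rewrite ew mem0v.
exists w => //; split=> // d [M FM Md].
have [M' [FM' M0M'] M'd] : exists2 M', Fam0 M' & M' d.
  by have [s|s] := tot FM0 FM; [exists M|exists M0 => //; [split|apply: s]].
have [w' [N0w' hw'] ww'] : Y M' (kap (ev w)).
  by apply: (Ymin M') => //; exists w.
have fl : flag E (w - w').
  split; first by apply: KB; [case: N0w|case: N0w'].
  by apply/kap0; rewrite evD kapD ww' (additive_mapN _ evD) (additive_mapN _ kapD) subrr.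
have Ld : L d by exists M.
have := flagD _ _ (EL _ _ Ld fl) (hw' _ M'd).
by rewrite additive_mapB ?subrK //; apply: DD.
Qed.

(** A flag of invariants exhausts the module, and an element of one layer is a
    scalar times a vector invariant modulo the previous layer: the action on the
    layer is the action on the scalar, which [union_field] controls. *)
Theorem union_module w : K w -> (forall M, Fam M -> tnil D M B0 w) -> tnil D L B0 w.
Proof.
move=> Kw hw; have N0w : N0 w by split.
suff H k (E : {vspace vT}) : (\dim (fullv : {vspace vT}) <= \dim E + k)%N ->
    (forall d w, L d -> flag E w -> flag E (D d w)) -> N0 `&` flag E `<=` S -> N0 `<=` S.
  apply: (H (\dim (fullv : {vspace vT})) 0%VS) N0w; first by rewrite leq_addl.
    move=> d x Ld [Kx]; rewrite memv0 => /eqP ex.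
    have [? e0] : B0 (D d x) by apply: B0L.
    by split; rewrite // e0 memv0.
  by move=> x [_ [Kx]]; rewrite memv0 => /eqP ex; apply: tnil_base.
elim: k E => [|k ih] E hk EL ES.
  have E1 : E = fullv by apply/eqP; rewrite eqEdim subvf -[\dim E]addn0.
  by move=> x N0x; apply: ES; split=> //; split; [case: N0x|rewrite E1 memvf].
have [sub|] := pselect (N0 `<=` flag E).
  by move=> x N0x; apply: ES; split=> //; apply: sub.
move=> /(extend_flag EL)[v N0v [nEv vL]].
have Kv : K v by case: N0v.
have evE : ev v \notin E by apply/negP => h; apply: nEv; split.
have ev0 : ev v != 0 by apply: contraNneq evE => ->; rewrite mem0v.
pose E' := (E + <[ev v]>)%VS.
have dimE' : \dim E' = (\dim E).+1.
  rewrite dimv_disjoint_sum ?dim_vline ?ev0 ?addn1 //.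
  apply/eqP; rewrite -subv0; apply/subvP => x /memv_capP[xE /vlineP[c xc]].
  rewrite memv0; have [c0|c0] := eqVneq c 0; first by rewrite xc c0 scale0r.
  case/negP: evE; have -> : ev v = c^-1 *: x by rewrite xc scalerA mulVf // scale1r.
  exact: memvZ.
have E'P x : flag E' x -> exists f, flag E (x - f *: v).
  move=> [Kx /memv_addP[a aE [_ /vlineP[f ->] e]]]; exists f; split.
    by apply: KB => //; apply: KZ.
  by rewrite evD (additive_mapN _ evD) evZ e addrK.
have PE' f x : K x -> flag E (x - f *: v) -> flag E' x.
  move=> Kx [_ h]; split=> //; rewrite -(subrK (f *: v) x) evD evZ.
  by apply: memv_add => //; apply/memvZ/memv_line.
have flagD x y : flag E x -> flag E y -> flag E (x + y).
  by move=> [Kx ex] [Ky ey]; split; [apply: KD|rewrite evD memvD].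
have flagZ f x : flag E x -> flag E (f *: x).
  by move=> [Kx ex]; split; [apply: KZ|rewrite evZ memvZ].
have step d x f : L d -> flag E (x - f *: v) -> flag E (D d x - delta d f *: v).
  move=> Ld h; have := EL _ _ Ld h; rewrite additive_mapB ?DZ //; last exact: DD.
  move=> /flagD/(_ (flagZ f _ (vL _ Ld))).
  by rewrite opprD addrA subrK.
apply: (ih E').
- by rewrite dimE' addSnnS.
- move=> d x Ld hx; have [f hf] := E'P _ hx.
  by apply: (PE' (delta d f)); [apply: KL => //; case: hx|apply: step].
move=> x [N0x /E'P[f hf]].
have tf : tnil delta L null f.
  apply: scalars => M FM.
  apply: (tnil_sim (R := fun w f => flag E (w - f *: v))) (N0x.2 _ FM) hf.
    move=> w' f' [_ h] [Kw' e]; rewrite /null /=; apply: contrapT => /eqP f0.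
    case/negP: evE; move: h.
    rewrite evD (additive_mapN _ evD) e add0r evZ memvN => h.
    have -> : ev v = f'^-1 *: (f' *: ev v) by rewrite scalerA mulVf // scale1r.
    exact: memvZ.
  by move=> w' f' d h Md; exists d => //; apply: step => //; apply: ML Md.
elim: tf x N0x hf => {f} [f ->|f _ ihf] x N0x hf.
  by apply: ES; split=> //; move: hf; rewrite scale0r subr0.
apply: tnil_step => d Ld; apply: (ihf d Ld); first exact: N0L.
exact: step.
Qed.

End UnionModule.

(** * The residue field of a prime ideal *)

(** The quotient by a prime ideal has a commutative ring structure only; a choice
    of inverses makes it an integral domain, as the construction of its field of
    fractions requires. *)
Section PrimeQuotient.
Variables (A : comNzRingType) (I : prime_idealr A).

Definition prime_quot := {ideal_quot I}.
HB.instance Definition _ := GRing.ComNzRing.on prime_quot.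

Definition prime_quot_unit : pred prime_quot := fun x => `[< exists y, y * x = 1 >].

Definition prime_quot_inv (x : prime_quot) : prime_quot :=
  if pselect (exists y, y * x = 1) is left h then sval (cid h) else x.

Lemma prime_quot_mulVx : {in prime_quot_unit, left_inverse 1 prime_quot_inv *%R}.
Proof.
by move=> x /asboolP h; rewrite /prime_quot_inv; case: pselect => // h'; case: cid.
Qed.

Lemma prime_quot_unitPl x y : y * x = 1 -> prime_quot_unit x.
Proof. by move=> h; apply/asboolP; exists y. Qed.

Lemma prime_quot_inv_out : {in [predC prime_quot_unit], prime_quot_inv =1 id}.
Proof. by move=> x /asboolP h; rewrite /prime_quot_inv; case: pselect. Qed.

HB.instance Definition _ := GRing.ComNzRing_hasMulInverse.Build prime_quot
  prime_quot_mulVx prime_quot_unitPl prime_quot_inv_out.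

Lemma prime_quot_integral (x y : prime_quot) : x * y = 0 -> (x == 0) || (y == 0).
Proof. exact: Quotient.rquot_IdomainAxiom. Qed.

HB.instance Definition _ :=
  GRing.ComUnitRing_isIntegral.Build prime_quot prime_quot_integral.
End PrimeQuotient.

Lemma residue_field (A : comNzRingType) (q : set A) :
    (forall a x y, q x -> q y -> q (a * x + y)) -> q 0 -> ~ q 1 ->
    (forall x y, q (x * y) -> q x \/ q y) ->
  exists (F : fieldType) (pi : {rmorphism A -> F}),
    (forall a, pi a = 0 <-> q a) /\
    (forall f : F, exists a b, ~ q b /\ f = pi a / pi b).
Proof.
move=> qlin q0 q1 qprime.
pose S : A -> bool := fun a => `[< q a >].
have Sid : idealr_closed S.
  split; first exact/asboolP.
    by apply/negP => /asboolP.
  by move=> a x y /asboolP qx /asboolP qy; apply/asboolP; apply: qlin.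
have Spr : prime_idealr_closed S.
  by move=> x y /asboolP /qprime [] h; apply/orP; [left|right]; apply/asboolP.
pose I : prime_idealr A :=
  HB.pack S (isIdealr.Build A S Sid) (isPrimeIdealrClosed.Build A S Spr).
pose Q := prime_quot I.
pose pq : {rmorphism A -> Q} := (\pi_Q)%qT.
pose pi : {rmorphism A -> {fraction Q}} := (@FracField.tofrac Q) \o pq.
have piE a : pi a = FracField.tofrac (pq a) by [].
have pq0 a : pq a = 0 <-> q a.
  have -> : (pq a = 0) <-> (pq a == pq 0).
    by rewrite rmorph0; split=> [->|/eqP].
  rewrite /pq /= -[X in _ <-> q X]subr0.
  have -> : q (a - 0) <-> (a - 0 \in I) by split=> [h|/asboolP //]; apply/asboolP.
  by rewrite Quotient.idealrBE.
exists {fraction Q}, pi; split=> [a|f].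
  rewrite piE -pq0; split=> [/eqP|->]; last by rewrite rmorph0.
  by rewrite tofrac_eq0 => /eqP.
set r : {ratio Q} := (repr f)%qT.
have d0 : \d_r != 0 by exact: denom_ratioP.
have fE : f * FracField.tofrac \d_r = FracField.tofrac \n_r.
  unlock FracField.tofrac; rewrite -[f]reprK -[LHS]FracField.pi_mul.
  apply/eqmodP => /=; rewrite FracField.equivfE /FracField.mulf -/r.
  by rewrite !numden_Ratio ?oner_neq0 ?mulr1 // mulrC.
have prE x : pq (repr x)%qT = x by rewrite /pq /= reprK.
exists (repr \n_r)%qT, (repr \d_r)%qT; split.
  by move/pq0; rewrite prE => h; rewrite h eqxx in d0.
rewrite !piE !prE -fE mulfK // tofrac_eq0 //.
Qed.

(** * Derivations of fields of fractions *)

Section FractionDerivation.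
Variables (A : comNzRingType) (q : set A) (F : fieldType) (pi : {rmorphism A -> F}).
Hypothesis pi0 : forall a, pi a = 0 <-> q a.
Hypothesis pifrac : forall f : F, exists a b, ~ q b /\ f = pi a / pi b.

Lemma deriv_frac (d : F -> F) f g : deriv d -> g != 0 -> d (f / g) = (d f - f / g * d g) / g.
Proof.
move=> [dD dM] g0; have := dM (f / g) g; rewrite divfK // => ->.
by rewrite addrK mulfK.
Qed.

Lemma deriv_ext (d e : F -> F) : deriv d -> deriv e ->
  (forall a, d (pi a) = e (pi a)) -> forall f, d f = e f.
Proof.
move=> hd he de f; have [a [b [qb ->]]] := pifrac f.
have b0 : pi b != 0 by apply/eqP => /pi0.
by rewrite !deriv_frac // !de.
Qed.

(** With [f = a / b] the value [d' f] must be [(d a - f * d b) / b]; it does not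
    depend on [a] and [b] because [d] preserves [q]. *)
Lemma fraction_derivation (d : A -> A) : additive_map d ->
    leibniz d -> (forall a, q a -> q (d a)) ->
  exists d' : F -> F, deriv d' /\ forall a, d' (pi a) = pi (d a).
Proof.
move=> dD dM dq.
have /choice[ab hab] : forall f : F, exists x : A * A, ~ q x.2 /\ f = pi x.1 / pi x.2.
  by move=> f; have [a [b h]] := pifrac f; exists (a, b).
pose d' f := (pi (d (ab f).1) - f * pi (d (ab f).2)) / pi (ab f).2.
have d'E f a b : ~ q b -> f * pi b = pi a -> d' f * pi b = pi (d a) - f * pi (d b).
  move=> qb fb; rewrite /d'; have [qb' fb'] := hab f.
  set a' := (ab f).1 in qb' fb' *; set b' := (ab f).2 in qb' fb' *.
  have b0 : pi b' != 0 by apply/eqP => /pi0.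
  have fb2 : f * pi b' = pi a' by rewrite fb' divfK.
  have : q (a * b' - a' * b).
    by apply/pi0; rewrite rmorphB !rmorphM -fb -fb2; ring.
  move=> /dq/pi0; rewrite additive_mapB // rmorphB !dM !rmorphD !rmorphM -fb -fb2 => h.
  apply: (mulIf b0); rewrite mulrAC divfK //.
  apply: subr0_eq; rewrite -[RHS]oppr0 -h.
  ring.
have d'U f a b x : ~ q b -> f * pi b = pi a -> x * pi b = pi (d a) - f * pi (d b) -> d' f = x.
  move=> qb fb xb; have b0 : pi b != 0 by apply/eqP => /pi0.
  by apply: (mulIf b0); rewrite xb; apply: d'E.
have nz b : ~ q b -> pi b != 0 by move=> qb; apply/eqP => /pi0.
have qM b c : ~ q b -> ~ q c -> ~ q (b * c).
  by move=> /nz b0 /nz c0 /pi0; rewrite rmorphM => /eqP; rewrite mulf_eq0 (negPf b0) (negPf c0).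
have fr f : exists a b, ~ q b /\ f * pi b = pi a.
  by have [a [b [qb ->]]] := pifrac f; exists a, b; rewrite divfK ?nz.
exists d'; split; last first.
  move=> a; apply: (d'U _ a 1).
  - by move=> /pi0/eqP; rewrite rmorph1 oner_eq0.
  - by rewrite rmorph1 mulr1.
  by rewrite (leibniz1 dM) rmorph0 rmorph1 mulr0 subr0 mulr1.
split=> f g; have [a [b [qb fb]]] := fr f; have [a' [b' [qb' gb]]] := fr g.
  apply: (d'U _ (a * b' + a' * b) (b * b')); first exact: qM.
    by rewrite rmorphD !rmorphM -fb -gb; ring.
  rewrite dD !dM !rmorphD !rmorphM mulrDl.
  rewrite [d' f * _]mulrA (d'E _ _ _ qb fb) [d' g * _]mulrCA (d'E _ _ _ qb' gb) -fb -gb.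
  ring.
apply: (d'U _ (a * a') (b * b')); first exact: qM.
  by rewrite !rmorphM -fb -gb; ring.
rewrite !dM !rmorphD !rmorphM.
have -> : (d' f * g + f * d' g) * (pi b * pi b') =
  (d' f * pi b) * (g * pi b') + (f * pi b) * (d' g * pi b') by ring.
rewrite (d'E _ _ _ qb fb) (d'E _ _ _ qb' gb) -fb -gb.
ring.
Qed.

End FractionDerivation.

(** * Torsion free modules of finite type *)

(** The subquotient [P / Q] as a torsion free module of finite type over the
    domain [A / q], where [A] acts through [act] modulo [Q].  The action need not
    be the multiplication: in positive characteristic it is multiplication
    by [p]-th powers. *)
Section Localized.
Variables (A : comNzRingType) (P Q q : set A) (act : A -> A -> A).
Hypothesis Q0 : Q 0.
Hypothesis QB : forall x y, Q x -> Q y -> Q (x - y).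
Hypothesis P0 : P 0.
Hypothesis PB : forall x y, P x -> P y -> P (x - y).
Hypothesis q0 : q 0.
Hypothesis q1 : ~ q 1.
Hypothesis qprime : forall x y, q (x * y) -> q x \/ q y.
Hypothesis actD : forall a, additive_map (act a).
Hypothesis actP : forall a y, P y -> P (act a y).
Hypothesis actQ : forall a y, Q y -> Q (act a y).
Hypothesis actDl : forall a b y, P y -> Q (act (a + b) y - (act a y + act b y)).
Hypothesis actA : forall a b y, P y -> Q (act (a * b) y - act a (act b y)).
Hypothesis act1 : forall y, P y -> Q (act 1 y - y).
Hypothesis act_tf : forall a y, P y -> Q (act a y) -> q a \/ Q y.
Hypothesis act_q : forall a y, q a -> P y -> Q (act a y).
Variables (m : nat) (gs : 'I_m -> A).
Hypothesis gsP : forall i, P (gs i).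
Hypothesis gs_gen : forall y, P y -> exists c : 'I_m -> A, Q (y - \sum_i act (c i) (gs i)).

Local Notation "x =Q y" := (Q (x - y)) (at level 70).

Let QN x : Q x -> Q (- x).
Proof. by move=> Qx; rewrite -sub0r; apply: QB. Qed.
Let QD x y : Q x -> Q y -> Q (x + y).
Proof. by move=> Qx Qy; rewrite -[y]opprK; apply: QB => //; apply: QN. Qed.
Let PD x y : P x -> P y -> P (x + y).
Proof.
by move=> Px Py; rewrite -[y]opprK; apply: (PB) => //; rewrite -sub0r; apply: (PB).
Qed.
Let Psum (k : nat) (f : 'I_k -> A) : (forall i, P (f i)) -> P (\sum_i f i).
Proof. by move=> h; apply: big_ind => //; apply: PD. Qed.
Let eqm_refl x : x =Q x.
Proof. by rewrite subrr. Qed.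
Let eqm_sym x y : x =Q y -> y =Q x.
Proof. by move=> /QN; rewrite opprB. Qed.
Let eqm_trans y x z : x =Q y -> y =Q z -> x =Q z.
Proof. by move=> h1 h2; have := QD h1 h2; rewrite addrA subrK. Qed.
Let eqmD x y x' y' : x =Q x' -> y =Q y' -> x + y =Q x' + y'.
Proof. by move=> h1 h2; rewrite opprD addrACA; apply: QD. Qed.
Let eqm_act a x y : x =Q y -> act a x =Q act a y.
Proof. by move=> h; rewrite -(additive_mapB _ _ (actD a)); apply: actQ. Qed.
Let eqm_sum (k : nat) (f g : 'I_k -> A) : (forall i, f i =Q g i) -> \sum_i f i =Q \sum_i g i.
Proof. by move=> h; apply: (big_ind2 (fun x y => x =Q y)) => // *; apply: eqmD. Qed.
Let eqmQ x y : x =Q y -> Q y -> Q x.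
Proof. by move=> h Qy; have := QD h Qy; rewrite subrK. Qed.

Section Lin.
Variables (r : nat) (b : 'I_r -> A).
Hypothesis bP : forall i, P (b i).
Definition lin (c : 'I_r -> A) := \sum_i act (c i) (b i).

Lemma linP c : P (lin c). Proof. by apply: Psum => i; apply: actP. Qed.

Lemma linD c c' : lin (fun i => c i + c' i) =Q lin c + lin c'.
Proof.
have := eqm_sum (fun i => actDl (c i) (c' i) (bP i)).
by rewrite big_split.
Qed.

Lemma linZ a c : lin (fun i => a * c i) =Q act a (lin c).
Proof.
rewrite /lin (additive_map_sum _ _ (actD a)); exact: (eqm_sum (fun i => actA a (c i) (bP i))).
Qed.

Lemma linN c : lin (fun i => - c i) =Q - lin c.
Proof.
rewrite /lin -sumrN; apply: (eqm_sum (g := fun i => - _)) => i; rewrite opprK.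
have h := actDl (- c i) (c i) (bP i).
have : Q (act (- c i + c i) (b i)) by rewrite addNr; apply: act_q.
by move=> /QB/(_ h); rewrite subKr.
Qed.

Definition indep := forall c, Q (lin c) -> forall i, q (c i).

Definition fraction_of y a c := ~ q a /\ act a y =Q lin c.
Definition ratdep y := exists a c, fraction_of y a c.

Lemma ratdep_Q y : Q y -> ratdep y.
Proof.
move=> Qy; exists 1, (fun=> 0); split=> //.
apply: QB; first exact: actQ.
by apply: big_ind => // i _; apply: act_q.
Qed.

Lemma fraction_ofD x y a c a' c' : P x -> P y -> fraction_of x a c -> fraction_of y a' c' ->
  fraction_of (x + y) (a * a') (fun i => a' * c i + a * c' i).
Proof.
move=> Px Py [qa ha] [qa' ha']; split; first by case/qprime.
apply: eqm_trans (eqm_sym (linD _ _)); rewrite actD; apply: eqmD.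
  apply: eqm_trans (eqm_sym (linZ _ _)); rewrite mulrC.
  by apply: eqm_trans (eqm_act _ ha); apply: actA.
apply: eqm_trans (eqm_sym (linZ _ _)).
by apply: eqm_trans (eqm_act _ ha'); apply: actA.
Qed.

Lemma fraction_ofZ a y a' c : P y -> fraction_of y a' c ->
  fraction_of (act a y) a' (fun i => a * c i).
Proof.
move=> Py [qa' ha']; split=> //.
apply: eqm_trans (eqm_sym (linZ _ _)); apply: eqm_trans (eqm_act _ ha').
apply: eqm_trans (actA _ _ Py); rewrite mulrC; apply: eqm_sym; exact: actA.
Qed.
End Lin.

(** Among the generators, keep those that are independent of the later ones. *)
Lemma rational_basis k (g : 'I_k -> A) : (forall i, P (g i)) ->
  exists r (b : 'I_r -> A), [/\ forall i, P (b i), indep b & forall i, ratdep b (g i)].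
Proof.
elim: k g => [|k ih] g gP.
  by exists 0%N, (fun=> 0); split=> // [c _|] [].
have [r [b [bP bi bg]]] := ih (fun i => g (lift ord0 i)) (fun i => gP _).
have [h|h] := pselect (ratdep b (g ord0)).
  by exists r, b; split=> // i; case: (unliftP ord0 i) => [j ->|->].
pose b' (i : 'I_r.+1) := if unlift ord0 i is Some j then b j else g ord0.
have b'0 : b' ord0 = g ord0 by rewrite /b' unlift_none.
have b'l j : b' (lift ord0 j) = b j by rewrite /b' liftK.
have linE c : lin b' c = act (c ord0) (g ord0) + lin b (fun j => c (lift ord0 j)).
  by rewrite /lin big_ord_recl b'0; congr (_ + _); apply: eq_bigr => j _; rewrite b'l.
have b'P i : P (b' i) by rewrite /b'; case: unlift.
exists r.+1, b'; split=> //.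
- move=> c; rewrite linE => hc.
  have [qc0|qc0] := pselect (q (c ord0)).
    have hl : Q (lin b (fun j => c (lift ord0 j))).
      by have := QB hc (act_q qc0 (gP ord0)); rewrite addrC addKr.
    by move=> i; case: (unliftP ord0 i) => [j ->|->//]; apply: (bi _ hl j).
  case: h; exists (c ord0), (fun j => - c (lift ord0 j)); split=> //.
  apply: eqm_trans (eqm_sym (linN bP _)).
  by rewrite opprK.
- move=> i; case: (unliftP ord0 i) => [j ->|->].
    have [a [c [qa hc]]] := bg j.
    exists a, (fun i => if unlift ord0 i is Some j then c j else 0); split=> //.
    rewrite linE unlift_none; under eq_fun do rewrite liftK.
    rewrite -[act a _]add0r; apply: eqmD => //.
    by apply: eqm_sym; rewrite subr0; apply: act_q.
  exists 1, (fun i => if unlift ord0 i is Some j then 0 else 1); split=> //.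
  rewrite linE unlift_none; under eq_fun do rewrite liftK.
  rewrite -[X in X - _]addr0; apply: eqmD => //.
  apply: eqm_sym; rewrite subr0; apply: big_ind => // j _; exact: act_q.
Qed.

Variables (F : fieldType) (pi : {rmorphism A -> F}).
Hypothesis pi0 : forall a, pi a = 0 <-> q a.

Let pi_neq0 a : ~ q a -> pi a != 0.
Proof. by move=> qa; apply/eqP => /pi0. Qed.

(** The embedding of a torsion free module into its localization, in the
    coordinates of a rational basis. *)
Lemma module_coordinates : exists r (b : 'I_r -> A) (phi : A -> 'rV[F]_r),
  [/\ (forall i, P (b i)),
      (forall x y, P x -> P y -> phi (x + y) = phi x + phi y),
      (forall a y, P y -> phi (act a y) = pi a *: phi y),
      (forall y, P y -> (phi y = 0 <-> Q y)) &
      (forall i, phi (b i) = delta_mx 0 i) /\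
      (forall y, P y -> exists a c, ~ q a /\ act a y =Q lin b c)].
Proof.
have [r [b [bP bi bg]]] := rational_basis gsP.
have rat y : P y -> ratdep b y.
  move=> Py; have [c hc] := gs_gen Py.
  have : ratdep b (\sum_i act (c i) (gs i)).
    suff [] : P (\sum_i act (c i) (gs i)) /\ ratdep b (\sum_i act (c i) (gs i)) by [].
    apply: (big_ind (fun x => P x /\ ratdep b x)).
    - by split=> //; apply: ratdep_Q.
    - move=> x x' [Px [a [d hx]]] [Px' [a' [d' hx']]]; split; first exact: PD.
      by exists (a * a'), (fun i => a' * d i + a * d' i); apply: fraction_ofD.
    - move=> i _; split; first exact: actP.
      have [a [d h]] := bg i.
      by exists a, (fun j => c i * d j); apply: fraction_ofZ.
  move=> [a [d [qa h]]]; exists a, d; split=> //.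
  by apply: eqm_trans (eqm_act a hc) h.
have /choice[ac hac] : forall y, exists ac : A * ('I_r -> A), P y -> fraction_of b y ac.1 ac.2.
  move=> y; have [Py|nPy] := pselect (P y); last by exists (0, fun=> 0).
  by have [a [c h]] := rat y Py; exists (a, c).
pose phi y : 'rV[F]_r := \row_i (pi ((ac y).2 i) / pi (ac y).1).
have phiE y a c : P y -> fraction_of b y a c -> forall i, phi y 0 i = pi (c i) / pi a.
  move=> Py [qa hy] i; have [qa' hy'] := hac y Py.
  set a' := (ac y).1 in qa' hy'; set c' := (ac y).2 in hy'.
  have h : lin b (fun i => a * c' i) =Q lin b (fun i => a' * c i).
    apply: eqm_trans (linZ bP _ _) _.
    apply: eqm_trans (eqm_act _ (eqm_sym hy')) _.
    apply: eqm_trans (eqm_sym (actA _ _ Py)) _; rewrite mulrC.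
    apply: eqm_trans (actA _ _ Py) _.
    apply: eqm_trans (eqm_act _ hy) _; apply: eqm_sym; exact: linZ.
  have hq : Q (lin b (fun i => a * c' i - a' * c i)).
    apply: eqmQ (linD bP _ _) _.
    by apply: eqmQ h; apply: eqmD => //; exact: linN.
  have /pi0 := bi _ hq i; rewrite rmorphB !rmorphM mxE -/a' -/c' => /subr0_eq e.
  by apply/eqP; rewrite eqr_div ?pi_neq0 //; apply/eqP; rewrite mulrC e mulrC.
exists r, b, phi; split=> //.
- move=> x y Px Py; apply/rowP => i.
  have hx := hac _ Px; have hy := hac _ Py.
  rewrite (phiE _ _ _ (PD Px Py) (fraction_ofD bP Px Py hx hy)) !mxE.
  rewrite rmorphD !rmorphM; have := pi_neq0 hx.1; have := pi_neq0 hy.1 => h1 h2.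
  by field; rewrite h1 h2.
- move=> a y Py; apply/rowP => i.
  have hy := hac _ Py.
  rewrite (phiE _ _ _ (actP a Py) (fraction_ofZ bP a Py hy)) !mxE.
  by rewrite rmorphM mulrA.
- move=> y Py; have [qa h] := hac _ Py; split=> [e|Qy].
    have hc i : q ((ac y).2 i).
      apply/pi0; have := congr1 (fun v : 'rV_r => v 0 i) e; rewrite !mxE => /eqP.
      by rewrite mulf_eq0 invr_eq0 (negPf (pi_neq0 qa)) orbF => /eqP.
    have Qa : Q (act (ac y).1 y).
      by apply: eqmQ h _; apply: big_ind => // i _; apply: act_q.
    by case: (act_tf Py Qa).
  apply/rowP => i; rewrite !mxE; have -> : pi ((ac y).2 i) = 0; last by rewrite mul0r.
  apply/pi0; apply: (bi (ac y).2).
  by apply: eqmQ (eqm_sym h) _; apply: actQ.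
split=> [i|y Py]; last by have [? ?] := hac _ Py; exists (ac y).1, (ac y).2.
apply/rowP => j; rewrite (phiE _ 1 (fun j => (i == j)%:R)) //.
  by rewrite rmorph1 divr1 mxE eqxx rmorph_nat eq_sym.
split=> //; apply: eqm_trans (act1 (bP i)) _.
rewrite /lin (bigD1 i) //= eqxx -[b i]addr0; apply: eqmD.
  by apply: eqm_sym; apply: eqm_trans (act1 _); rewrite ?addr0.
apply: eqm_sym; rewrite subr0; apply: big_ind => // j' /negPf ne.
by rewrite eq_sym ne; apply: act_q.
Qed.

Hypothesis pifrac : forall f : F, exists a b, ~ q b /\ f = pi a / pi b.
Variables (L : set (A -> A)) (d0 : (A -> A) -> A -> A) (n : nat) (zs : 'I_n -> A).
Hypothesis Ladd : forall d, L d -> additive_map d.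
Hypothesis Lcomm : forall d e, L d -> L e -> L (comm d e).
Hypothesis LP : forall d y, L d -> P y -> P (d y).
Hypothesis LQ : forall d y, L d -> Q y -> Q (d y).
Hypothesis Lnil : forall d y, L d -> P y -> exists k, Q (iter k d y).
Hypothesis d0D : forall d, L d -> additive_map (d0 d).
Hypothesis d0M : forall d, L d -> leibniz (d0 d).
Hypothesis d0q : forall d a, L d -> q a -> q (d0 d a).
Hypothesis d0act : forall d a y, L d -> P y ->
  d (act a y) =Q act (d0 d a) y + act a (d y).
Hypothesis d0comm : forall d e a, L d -> L e -> d0 (comm d e) a = comm (d0 d) (d0 e) a.
Hypothesis zs_gen : forall G : set A, G 1 -> (forall x y, G x -> G y -> G (x - y)) ->
  (forall x y, G x -> G y -> G (x * y)) -> (forall i, G (zs i)) -> forall a, G a.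

(** The module [P / Q] sits in a space [F ^ r] on which [L] acts by semilinear
    maps [D], and [L] itself, modulo the elements that kill [P / Q], sits in the
    finite dimensional space spanned by the maps [phi \o d].  So [union_module]
    gives both conditions on chains in [engel_zorn]. *)
Theorem localized_engel y : P y -> tnil app L Q y.
Proof.
have [r [b [phi [bP phiD phiZ phi0 [phib coord]]]]] := module_coordinates.
have phiN x : P x -> phi (- x) = - phi x.
  move=> Px; apply: (addIr (phi x)); have PNx : P (- x) by rewrite -sub0r; apply: PB.
  by rewrite -phiD // !addNr; apply/phi0.
have phiB x x' : P x -> P x' -> phi (x - x') = phi x - phi x'.
  move=> Px Px'; have PNx : P (- x') by rewrite -sub0r; apply: PB.
  by rewrite phiD // phiN.
have phiQ x x' : P x -> P x' -> x =Q x' -> phi x = phi x'.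
  move=> Px Px' h; apply: subr0_eq; rewrite -phiB //; apply/phi0 => //.
  exact: PB.
have phisum k (f : 'I_k -> A) : (forall i, P (f i)) -> phi (\sum_i f i) = \sum_i phi (f i).
  move=> Pf; suff [] : P (\sum_i f i) /\ phi (\sum_i f i) = \sum_i phi (f i) by [].
  apply: (big_ind2 (fun x v => P x /\ phi x = v)) => //.
    by split=> //; apply/phi0.
  by move=> x v x' v' [Px <-] [Px' <-]; split; [apply: PD|rewrite phiD].
have /choice[delta hdelta] : forall d, exists e : F -> F, L d ->
    deriv e /\ forall a, e (pi a) = pi (d0 d a).
  move=> d; have [Ld|nLd] := pselect (L d); last by exists id.
  have [e he] := fraction_derivation pi0 pifrac (d0D Ld) (d0M Ld)
    (fun a => d0q Ld (a := a)).
  by exists e.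
have ddelta d : L d -> deriv (delta d) by move=> /hdelta[].
have deltapi d a : L d -> delta d (pi a) = pi (d0 d a) by move=> /hdelta[].
have deltac d e : L d -> L e -> delta (comm d e) = comm (delta d) (delta e).
  move=> Ld Le; apply/funext => f; apply: (deriv_ext pi0 pifrac).
  - by apply: ddelta; apply: Lcomm.
  - have hd := ddelta _ Ld; have he := ddelta _ Le; split=> x x'; rewrite /comm.
      by rewrite he.1 hd.1 hd.1 he.1 opprD addrACA.
    by rewrite he.2 hd.1 !hd.2 he.1 !he.2; ring.
  by move=> a; rewrite deltapi ?d0comm //; [rewrite /comm !deltapi // rmorphB|apply: Lcomm].
pose D d (v : 'rV[F]_r) : 'rV[F]_r := map_mx (delta d) v + \sum_i v 0 i *: phi (d (b i)).
have DD d : L d -> additive_map (D d).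
  move=> Ld v w; rewrite /D addrACA -big_split /=; congr (_ + _).
    by apply/rowP => i; rewrite !mxE (ddelta _ Ld).1.
  by apply: eq_bigr => i _; rewrite mxE scalerDl.
have DZ d f v : L d -> D d (f *: v) = delta d f *: v + f *: D d v.
  move=> Ld; rewrite /D scalerDr addrA scaler_sumr; congr (_ + _).
    by apply/rowP => i; rewrite !mxE (ddelta _ Ld).2.
  by apply: eq_bigr => i _; rewrite mxE scalerA.
have phid d x : L d -> P x -> phi (d x) = D d (phi x).
  move=> Ld Px; have [a [c [qa h]]] := coord x Px.
  have Pl : P (lin b c) by apply: linP.
  have e1 : pi a *: phi x = \sum_i pi (c i) *: delta_mx 0 i.
    rewrite -phiZ // (phiQ _ _ _ Pl h) //; last exact: actP.
    by rewrite phisum => [|i]; [apply: eq_bigr => i _; rewrite phiZ ?phib|apply: actP].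
  have xE : phi x = \sum_i (pi (c i) / pi a) *: delta_mx 0 i.
    apply: (scalerI (pi_neq0 qa)); rewrite e1 scaler_sumr; apply: eq_bigr => i _.
    by rewrite scalerA mulrCA mulfV ?mulr1 // pi_neq0.
  have e2 : pi (d0 d a) *: phi x + pi a *: phi (d x) =
      \sum_i (pi (d0 d (c i)) *: delta_mx 0 i + pi (c i) *: phi (d (b i))).
    rewrite -!phiZ // -?phiD; try by [apply: actP|apply: LP|apply/actP/LP].
    have h1 : phi (d (act a x)) = phi (d (lin b c)).
      apply: phiQ; try by [apply/LP/actP|apply: LP].
      by rewrite -additive_mapB; [apply: LQ|apply: Ladd].
    rewrite -(phiQ _ _ _ _ (d0act a Ld Px)); last first.
    - by apply: PD; apply: actP => //; apply: LP.
    - by apply/LP/actP.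
    rewrite h1 /lin additive_map_sum; last exact: Ladd.
    rewrite phisum => [|i]; last by apply/LP/actP.
    apply: eq_bigr => i _.
    rewrite (phiQ _ _ _ _ (d0act (c i) Ld (bP i))); last first.
    - by apply: PD; apply: actP => //; apply: LP.
    - by apply/LP/actP.
    rewrite phiD; try by [apply: actP|apply/actP/LP].
    by rewrite !phiZ ?phib //; apply: LP.
  have -> : phi (d x) = (pi a)^-1 *:
      (\sum_i (pi (d0 d (c i)) *: delta_mx 0 i + pi (c i) *: phi (d (b i))) -
       pi (d0 d a) *: phi x).
    by rewrite -e2 addrC addKr scalerA mulVf ?scale1r // pi_neq0.
  have xi i : phi x 0 i = pi (c i) / pi a.
    rewrite xE summxE (bigD1 i) //= !mxE !eqxx mulr1 big1 ?addr0 // => j /negPf ne.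
    by rewrite !mxE eqxx eq_sym ne mulr0.
  rewrite /D big_split /= addrAC scalerDr; congr (_ + _); last first.
    rewrite scaler_sumr; apply: eq_bigr => i _; rewrite xi scalerA.
    by rewrite mulrC.
  apply/rowP => j; rewrite !mxE xi summxE (bigD1 j) //= !mxE !eqxx mulr1 big1 ?addr0; last first.
    by move=> i /negPf ne; rewrite !mxE eqxx eq_sym ne mulr0.
  rewrite (deriv_frac _ (ddelta _ Ld)) ?pi_neq0 // !deltapi //.
  by rewrite mulrC [pi (d0 d a) * _]mulrC.
have wcF (M : set (A -> A)) : M `<=` L -> weakly_closed M ->
    weakly_closed [set delta d | d in M].
  move=> ML wM _ _ [d Md <-] [e Me <-].
  rewrite -!deltac; try exact: ML.
  by case: (wM _ _ Md Me) => h; [left|right]; [exists (comm d e)|exists (comm e d)].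
have detF (M : set (A -> A)) : M `<=` L -> forall s, lspan setT [set delta d | d in M] s ->
    (forall i, s (pi (zs i)) = 0) -> forall x, s x = 0.
  move=> ML s hs sz.
  have ds : deriv s by apply: lspan_deriv hs => _ [d /ML Ld <-]; apply: ddelta.
  have spi a : s (pi a) = 0.
    apply: (zs_gen (G := [set a | s (pi a) = 0])) => //=.
    - by rewrite rmorph1 deriv1.
    - by move=> x x' hx hx'; rewrite rmorphB (additive_mapB _ _ ds.1) hx hx' subrr.
    - by move=> x x' hx hx'; rewrite rmorphM ds.2 hx hx' mul0r mulr0 addr0.
  move=> x; have [a [a' [qa ->]]] := pifrac x.
  by rewrite deriv_frac ?pi_neq0 // !spi mulr0 subrr mul0r.
pose ys : seq A := [seq gs j | j <- enum 'I_m] ++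
  [seq act (zs i) (gs j) | i <- enum 'I_n, j <- enum 'I_m].
have ysg j : gs j \in ys by rewrite mem_cat map_f // mem_enum.
have ysz i j : act (zs i) (gs j) \in ys.
  by rewrite mem_cat orbC (allpairs_f (fun i j => act (zs i) (gs j))) // mem_enum.
have ysP x : x \in ys -> P x.
  rewrite mem_cat => /orP[/mapP[j _ ->]|/allpairsP[[i j] [_ _ ->]]] //=.
  exact: actP.
(* The adjoint action, extended to functions on [A] with values in [F ^ r], is
   semilinear; only the values on [P] matter. *)
pose N := A -> 'rV[F]_r.
pose zeroP : set N := [set u | forall x, P x -> u x = 0].
pose D' d (u : N) : N := fun x => D d (u x) - u (d x).
pose K : set N := [set u | exists k (f : 'I_k -> F) (l : 'I_k -> A -> A),
  (forall i, L (l i)) /\ forall x, P x -> u x = \sum_i f i *: phi (l i x)].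
(* An element of [K] behaves like a derivation with symbol [sg], which is
   determined by its values at [zs]; the values at the generators [gs] and at
   their multiples by [zs] determine everything. *)
have Kdet (u : N) : K u -> (forall x, x \in ys -> u x = 0) -> zeroP u.
  move=> [k [f [l [Ll uE]]]] uys.
  pose sg a := \sum_i f i * pi (d0 (l i) a).
  have uact a x : P x -> u (act a x) = sg a *: phi x + pi a *: u x.
    move=> Px; rewrite !uE //; last exact: actP.
    rewrite scaler_suml scaler_sumr -big_split /=; apply: eq_bigr => i _.
    rewrite (phiQ _ _ _ _ (d0act a (Ll i) Px)); last first.
    - by apply: PD; apply: actP => //; apply: LP.
    - by apply/LP/actP.
    rewrite phiD; try by [apply: actP|apply/actP/LP].
    by rewrite !phiZ ?scalerDr ?scalerA 1?[pi a * _]mulrC //; apply: LP.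
  have sgD : additive_map sg.
    move=> x x'; rewrite /sg -big_split /=; apply: eq_bigr => i _.
    by rewrite d0D // rmorphD mulrDr.
  have sgM x x' : sg (x * x') = sg x * pi x' + pi x * sg x'.
    rewrite /sg mulr_suml mulr_sumr -big_split /=; apply: eq_bigr => i _.
    by rewrite d0M // rmorphD !rmorphM; ring.
  have uQ x x' : P x -> P x' -> x =Q x' -> u x = u x'.
    move=> Px Px' h; rewrite !uE //; apply: eq_bigr => i _; congr (_ *: _).
    apply: phiQ; try exact: LP.
    by rewrite -additive_mapB; [apply: LQ|apply: Ladd].
  have uact0 c j : u (act c (gs j)) = 0.
    rewrite uact // (uys _ (ysg j)) scaler0 addr0.
    have [-> |gj0] := eqVneq (phi (gs j)) 0; first by rewrite scaler0.
    have sg0 a : sg a = 0.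
      apply: (zs_gen (G := [set a | sg a = 0])) => //=.
      - have h := sgM 1 1; rewrite !mulr1 rmorph1 mul1r mulr1 in h.
        by apply: (addIr (sg 1)); rewrite add0r -h.
      - by move=> x x' hx hx'; rewrite additive_mapB // hx hx' subrr.
      - by move=> x x' hx hx'; rewrite sgM hx hx' mul0r mulr0 addr0.
      move=> i; have := uys _ (ysz i j); rewrite uact // (uys _ (ysg j)) scaler0 addr0.
      by move=> /eqP; rewrite scaler_eq0 (negPf gj0) orbF => /eqP.
    by rewrite sg0 scale0r.
  move=> x Px; have [c hc] := gs_gen Px.
  rewrite (uQ _ _ Px _ hc); last by apply: Psum => i; apply: actP.
  rewrite uE; last by apply: Psum => i; apply: actP.
  under eq_bigr => i _.
    rewrite (additive_map_sum _ _ (Ladd (Ll i))) phisum; last by move=> j; apply/LP/actP.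
    rewrite scaler_sumr; over.
  rewrite exchange_big /= big1 // => j _.
  by rewrite -uE ?uact0 //; apply: actP.
have Kphi d : L d -> K (phi \o d).
  move=> Ld; exists 1%N, (fun=> 1), (fun=> d); split=> // x Px.
  by rewrite big_ord1 scale1r.
have addE (u v : N) x : (u + v) x = u x + v x by [].
have scaleE f (u : N) x : (f *: u) x = f *: u x by [].
have Kadd (u v : N) : K u -> K v -> K (u + v).
  move=> [k [f [l [Ll uE]]]] [k' [f' [l' [Ll' vE]]]].
  exists (k + k')%N,
    (fun i : 'I_(k + k') => match fintype.split i with inl j => f j | inr j => f' j end),
    (fun i : 'I_(k + k') => match fintype.split i with inl j => l j | inr j => l' j end); split.
    by move=> i; case: (fintype.split i).
  move=> x Px; rewrite addE uE // vE // big_split_ord /=.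
  congr (_ + _); apply: eq_bigr => i _.
    by rewrite (unsplitK (inl i)).
  by rewrite (unsplitK (inr i)).
have KZ f (u : N) : K u -> K (f *: u).
  move=> [k [g [l [Ll uE]]]]; exists k, (fun i => f * g i), l; split=> // x Px.
  rewrite scaleE uE // scaler_sumr; apply: eq_bigr => i _.
  by rewrite scalerA.
have K0 : K 0 by exists 0%N, (fun=> 0), (fun=> id); split=> [[]//|x _]; rewrite big_ord0.
have KD' d (u : N) : L d -> K u -> K (D' d u).
  move=> Ld [k [f [l [Ll uE]]]].
  have h1 : K (fun x => \sum_i delta d (f i) *: phi (l i x)).
    by exists k, (fun i => delta d (f i)), l.
  have h2 : K (fun x => \sum_i f i *: phi (comm d (l i) x)).
    by exists k, f, (fun i => comm d (l i)); split=> // i; apply: Lcomm.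
  have [k' [f' [l' [Ll' vE]]]] := Kadd _ _ h1 h2.
  exists k', f', l'; split=> // x Px; rewrite -vE // addE /D'.
  rewrite !uE //; last exact: LP.
  rewrite additive_map_sum; last exact: DD.
  rewrite -sumrB -big_split /=; apply: eq_bigr => i _.
  rewrite DZ // /comm phiB; try by apply: (LP); last apply: (LP).
  by rewrite -phid //; [rewrite scalerBr addrA|apply: LP].
pose ev (u : N) : 'M[F]_(size ys, r) := \matrix_(i, j) u ys`_i 0 j.
have ev0 (u : N) : K u -> ev u = 0 <-> zeroP u.
  move=> Ku; split=> [e|uz]; last first.
    by apply/matrixP => i j; rewrite !mxE uz ?mxE //; apply/ysP/mem_nth.
  apply: Kdet => // x xys; apply/rowP => j.
  have ix : (index x ys < size ys)%N by rewrite index_mem.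
  have := congr1 (fun M : 'M_(_, _) => M (Ordinal ix) j) e.
  by rewrite !mxE /= nth_index.
have DD' d : L d -> additive_map (D' d).
  move=> Ld u v; apply/funext => x; rewrite addE /D' !addE.
  by rewrite DD // opprD addrACA.
have DZ' d f (u : N) : L d -> D' d (f *: u) = delta d f *: u + f *: D' d u.
  move=> Ld; apply/funext => x; rewrite addE !scaleE /D' !scaleE DZ //.
  by rewrite -addrA -scalerBr.
pose Z : set (A -> A) := fun u => forall y, P y -> Q (u y).
apply: (@engel_zorn A L P Q ys) => //.
- move=> u Lu hu x Px; apply/phi0; first exact: LP.
  have h := Kdet _ (Kphi _ Lu) _ x Px; apply: h => x' x'ys.
  by apply/phi0; [apply/LP/ysP|apply: hu].
- move=> Fam [ne tot subL wcM] x Px hx.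
  have UL : \bigcup_(M in Fam) M `<=` L by move=> d [M /subL]; apply.
  have : tnil D (\bigcup_(M in Fam) M) [set w | setT w /\ id w = 0] (phi x).
    apply: (union_module (z := fun i => pi (zs i)) (delta := delta)) => //.
    + by move=> M FM; apply: wcF; [apply: subL|apply: wcM].
    + by move=> d /UL; apply: ddelta.
    + exact: detF.
    + by move=> d /UL; apply: DD.
    + by move=> d f w /UL; apply: DZ.
    + by move=> d w /UL Ld [_ ->]; split=> //=; apply/additive_map0/DD.
    move=> M FM; apply: (tnil_sim (R := fun x v => P x /\ v = phi x)) (hx _ FM) _ => //.
      by move=> x' _ [Px' ->] Qx'; split=> //=; apply/phi0.
    move=> x' _ d [Px' ->] Md; have Ld := subL _ FM _ Md.
    by exists d => //; split; [apply: LP|rewrite phid].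
  move=> h; apply: (tnil_sim (R := fun v x => P x /\ v = phi x)) h _ => //.
    by move=> _ x' [Px' ->] [_ /= e]; apply/phi0.
  move=> _ x' d [Px' ->] Ud; have Ld := UL _ Ud.
  by exists d => //; split; [apply: LP|rewrite phid].
- move=> Fam [ne tot subL wcM] u Lu hu.
  have UL : \bigcup_(M in Fam) M `<=` L by move=> d [M /subL]; apply.
  pose R (u : A -> A) (w : N) := [/\ L u, K w & forall x, P x -> w x = phi (u x)].
  have RD u' w d : L d -> R u' w -> R (comm d u') (D' d w).
    move=> Ld [Lu' Kw wE]; split; [exact: Lcomm|exact: KD'|move=> x Px].
    rewrite /D' !wE //; last exact: LP.
    rewrite -phid //; last exact: LP.
    by rewrite -phiB //; apply: LP => //; apply: LP.
  have : tnil D' (\bigcup_(M in Fam) M) [set w | K w /\ ev w = 0] (phi \o u).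
    apply: (union_module (z := fun i => pi (zs i)) (delta := delta)) => //.
    + by move=> M FM; apply: wcF; [apply: subL|apply: wcM].
    + by move=> d /UL; apply: ddelta.
    + exact: detF.
    + by move=> d /UL; apply: DD'.
    + by move=> d f w /UL; apply: DZ'.
    + by move=> d w /UL; apply: KD'.
    + by move=> v w; apply/matrixP => i j; rewrite !mxE ?addE ?mxE.
    + move=> f w; apply/matrixP => i j; rewrite !mxE.
      by rewrite ?scaleE ?mxE.
    + move=> d w /UL Ld [Kw /(ev0 _ Kw) w0].
      have Kd : K (D' d w) by apply: KD'.
      split=> //; apply/(ev0 _ Kd) => x Px; rewrite /D' !w0 //; last exact: LP.
      by rewrite (additive_map0 (DD _ Ld)) subr0.
    + exact: Kphi.
    move=> M FM; apply: (tnil_sim (R := R)) (hu _ FM) _.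
    + move=> u' w [Lu' Kw wE] Zu'; split=> //; apply/(ev0 _ Kw) => x Px.
      by rewrite wE //; apply/phi0; [apply: LP|apply: Zu'].
    + by move=> u' w d h Md; exists d => //; apply: RD => //; apply: subL Md.
    + by split=> //; apply: Kphi.
  move=> h; apply: (tnil_sim (R := fun w u => R u w)) h _.
  + move=> w u' [Lu' Kw wE] [_ /(ev0 _ Kw) w0] x Px.
    by apply/phi0; [apply: LP|rewrite -wE // w0].
  + by move=> w u' d h Ud; exists d => //; apply: RD => //; apply: UL.
  + by split=> //; apply: Kphi.
Qed.

End Localized.

(** * Noetherian rings *)

Section Noetherian.
Variable T : comNzRingType.
Implicit Types (B I S : set T) (x y : T).

Definition subring B := [/\ B 1, forall x y, B x -> B y -> B (x - y) &
  forall x y, B x -> B y -> B (x * y)].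

Definition ideal B I := [/\ I 0, I `<=` B & forall a x y, B a -> I x -> I y -> I (a * x + y)].

Inductive ideal_gen B S : set T :=
| ideal_gen0 : ideal_gen B S 0
| ideal_genS a g y of B a & S g & ideal_gen B S y : ideal_gen B S (a * g + y).

Definition noetherian B := forall I, ideal B I ->
  exists g : seq T, (forall x, x \in g -> I x) /\ I `<=` ideal_gen B [set` g].

Lemma subring0 B : subring B -> B 0.
Proof. by move=> [B1 BB _]; rewrite -(subrr 1); apply: BB. Qed.

Lemma subringD B x y : subring B -> B x -> B y -> B (x + y).
Proof.
move=> hB Bx By; have B0 := subring0 hB; have [_ BB _] := hB.
by rewrite -[y]opprK; apply: (BB) => //; rewrite -sub0r; apply: (BB).
Qed.

Lemma subringN1 B : subring B -> B (-1).
Proof. by move=> hB; rewrite -sub0r; have [? BB _] := hB; apply: BB => //; apply: subring0. Qed.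

Lemma subringX B x k : subring B -> B x -> B (x ^+ k).
Proof.
move=> [B1 _ BM] Bx; elim: k => [|k ih]; first by rewrite expr0.
by rewrite exprS; apply: BM.
Qed.

Lemma ideal_genD B S x y : ideal_gen B S x -> ideal_gen B S y -> ideal_gen B S (x + y).
Proof.
elim=> [|a g z Ba Sg _ ih] hy; first by rewrite add0r.
by rewrite -addrA; apply: ideal_genS => //; apply: ih.
Qed.

Lemma ideal_genZ B S a x : subring B -> B a -> ideal_gen B S x -> ideal_gen B S (a * x).
Proof.
move=> [_ _ BM] Ba; elim=> [|b g z Bb Sg _ ih]; first by rewrite mulr0; apply: ideal_gen0.
by rewrite mulrDr mulrA; apply: ideal_genS => //; apply: BM.
Qed.

Lemma ideal_gen_sub B B' S S' : B `<=` B' -> S `<=` S' -> ideal_gen B S `<=` ideal_gen B' S'.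
Proof.
move=> hB hS x; elim=> [|a g y /hB ? /hS ? _ ih]; first exact: ideal_gen0.
exact: ideal_genS.
Qed.

Lemma ideal_gen_in B S I : ideal B I -> S `<=` I -> ideal_gen B S `<=` I.
Proof.
by move=> [I0 _ IL] hS x; elim=> [//|a g y Ba /hS Ig _ Iy]; apply: IL.
Qed.

Definition prime_subring : set T := [set x | exists k : int, x = k%:~R].

Lemma subring_prime_subring : subring prime_subring.
Proof.
split; first by exists 1.
  by move=> _ _ [k ->] [l ->]; exists (k - l); rewrite rmorphB.
by move=> _ _ [k ->] [l ->]; exists (k * l); rewrite rmorphM.
Qed.

(** Division with remainder by the least positive integer in the ideal. *)
Lemma noetherian_prime_subring : noetherian prime_subring.
Proof.
move=> I [I0 IB IL].
have IN x : I x -> I (- x).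
  move=> Ix; have := IL (-1) x 0 _ Ix I0; rewrite mulN1r addr0; apply.
  exact: subringN1 subring_prime_subring.
pose P n := `[< I (n.+1)%:R >].
have [/asboolP exP|nexP] := boolP `[< exists n, P n >]; last first.
  exists [::]; split=> // x Ix; suff -> : x = 0 by apply: ideal_gen0.
  have [k xk] := IB _ Ix; case: k xk Ix => [[|n]|n] -> // Ix.
    by case/asboolP: nexP; exists n; apply/asboolP.
  by case/asboolP: nexP; exists n; apply/asboolP; rewrite -[_%:R]opprK; apply: IN.
case: (ex_minnP exP) => n /asboolP In minn.
exists [:: n.+1%:R]; split=> [x|x Ix]; first by rewrite inE => /eqP ->.
have [k xk] := IB _ Ix.
have zS : [set` [:: n.+1%:R : T]] n.+1%:R by rewrite /= inE.
suff -> : x = (k %/ n.+1)%Z%:~R * n.+1%:R.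
  rewrite -[X in ideal_gen _ _ X]addr0; apply: ideal_genS => //; last exact: ideal_gen0.
  by exists (k %/ n.+1)%Z.
have rE : ((k %% n.+1)%Z)%:~R = x - (k %/ n.+1)%Z%:~R * n.+1%:R :> T.
  have := congr1 (fun k : int => k%:~R : T) (divz_eq k n.+1).
  by rewrite rmorphD rmorphM -xk => ->; rewrite addrC addKr.
have Ir : I ((k %% n.+1)%Z)%:~R.
  rewrite rE addrC -mulNr; apply: IL => //.
  by exists (- (k %/ n.+1)%Z); rewrite rmorphN.
have r0 : (0 <= (k %% n.+1)%Z)%R by apply: modz_ge0.
have rlt : ((k %% n.+1)%Z < n.+1%:Z)%R by have := ltz_pmod k (d := n.+1%:Z) isT.
case: (k %% n.+1)%Z r0 rlt Ir rE => [[|r]|//] _ rlt Ir rE.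
  by apply/eqP; rewrite -subr_eq0 -rE.
have := minn r; rewrite leqNgt => /(_ _)/negP; case; first exact/asboolP.
exact: rlt.
Qed.

Section Hilbert.
Variables (B : set T) (x : T).
Hypothesis Bring : subring B.

(** Elements with an expression of degree less than [k] in [x]: not polynomials, as
    [x] may be algebraic over [B].  Hilbert's argument is applied to
    expressions, an element having several of them. *)
Fixpoint lower k : set T :=
  if k is k'.+1 then [set y | exists b c, [/\ B b, lower k' c & y = b * x ^+ k' + c]]
  else [set 0].

Definition adjoin : set T := [set y | exists k, lower k y].

Lemma lowerD k y w : lower k y -> lower k w -> lower k (y + w).
Proof.
elim: k y w => [|k ih] y w /=; first by move=> -> ->; rewrite addr0.
move=> [b [c [Bb hc ->]]] [b' [c' [Bb' hc' ->]]]; exists (b + b'), (c + c'); split.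
- exact: subringD.
- exact: ih.
- by rewrite mulrDl addrACA.
Qed.

Lemma lowerZ k a y : B a -> lower k y -> lower k (a * y).
Proof.
move=> Ba; elim: k y => [|k ih] y /=; first by move=> ->; rewrite mulr0.
move=> [b [c [Bb hc ->]]]; exists (a * b), (a * c); split; last by rewrite mulrDr mulrA.
- by have [_ _ BM] := Bring; apply: BM.
- exact: ih.
Qed.

Lemma lowerS k y : lower k y -> lower k.+1 y.
Proof.
by move=> hy; exists 0, y; split=> //; [apply: subring0|rewrite mul0r add0r].
Qed.

Lemma lower0 k : lower k 0.
Proof. by elim: k => // k /lowerS. Qed.

Lemma lower_le k l y : (k <= l)%N -> lower k y -> lower l y.
Proof.
by move=> /subnK <-; elim: (l - k)%N => // m ih /ih /lowerS.
Qed.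

Lemma lowerX k y : lower k y -> lower k.+1 (x * y).
Proof.
elim: k y => [|k ih] y; first by move=> ->; rewrite mulr0; apply: lower0.
move=> [b [c [Bb hc ->]]]; exists b, (x * c); split=> //; first exact: ih.
by rewrite mulrDr mulrCA -exprS.
Qed.

Lemma lowerXn k y n : lower k y -> lower (n + k) (x ^+ n * y).
Proof.
elim: n => [|n ih] hy; first by rewrite expr0 mul1r.
by rewrite exprS -mulrA addSn; apply/lowerX/ih.
Qed.

Lemma lowerM k l y w : lower k y -> lower l w -> lower (k + l) (y * w).
Proof.
move=> hy hw; elim: k y hy => [|k ih] y; first by move=> ->; rewrite mul0r; apply: lower0.
move=> [b [c [Bb hc ->]]]; rewrite mulrDl -mulrA; apply: lowerD.
  by apply: lowerZ => //; rewrite addSn; apply/lowerS/lowerXn.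
by rewrite addSn; apply/lowerS/ih.
Qed.

Lemma sub_adjoin : B `<=` adjoin.
Proof.
move=> b Bb; exists 1%N, b, 0; split=> //.
by rewrite expr0 mulr1 addr0.
Qed.

Lemma adjoin_x : adjoin x.
Proof.
exists 2%N; exists 1, 0; split; [by case: Bring|exact: (lower0 1%N)|].
by rewrite expr1 mul1r addr0.
Qed.

Lemma subring_adjoin : subring adjoin.
Proof.
split; first by apply: sub_adjoin; case: Bring.
  move=> y w [k hy] [l hw]; exists (maxn k l); apply: lowerD.
    exact: lower_le (leq_maxl _ _) hy.
  rewrite -mulN1r; apply: lowerZ; first exact: subringN1.
  exact: lower_le (leq_maxr _ _) hw.
by move=> y w [k hy] [l hw]; exists (k + l)%N; apply: lowerM.
Qed.

(** The ideals [lead k] of leading coefficients increase, hence are equal to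
    [lead K] from some [K] on.  Finitely many elements of [I] realize the leading
    coefficients for each [k <= K], their multiples by powers of [x] those for
    larger [k], and an element of [I] is reduced to zero by lowering its
    degree. *)
Lemma hilbert_basis : noetherian B -> noetherian adjoin.
Proof.
move=> nB I [I0 IB IL].
have Aring := subring_adjoin; have A1 : adjoin 1 by case: Aring.
have ID y w : I y -> I w -> I (y + w).
  by move=> Iy Iw; rewrite -[y]mul1r; apply: IL.
have IZ a y : adjoin a -> I y -> I (a * y).
  by move=> Aa Iy; rewrite -[_ * _]addr0; apply: IL.
pose lead k : set T := [set b | B b /\ exists2 c, lower k c & I (b * x ^+ k + c)].
have lead_ideal k : ideal B (lead k).
  split.
  - split; first exact: subring0.
    by exists 0; [exact: lower0|rewrite mul0r addr0].
  - by move=> b [].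
  - move=> a b b' Ba [Bb [c hc Ic]] [Bb' [c' hc' Ic']]; split.
      by apply: subringD => //; have [_ _ BM] := Bring; apply: BM.
    exists (a * c + c'); first by apply: lowerD => //; apply: lowerZ.
    have -> : (a * b + b') * x ^+ k + (a * c + c') =
      a * (b * x ^+ k + c) + (b' * x ^+ k + c') by ring.
    by apply: IL => //; apply: sub_adjoin.
have leadS k : lead k `<=` lead k.+1.
  move=> b [Bb [c hc Ic]]; split=> //; exists (x * c); first exact: lowerX.
  have -> : b * x ^+ k.+1 + x * c = x * (b * x ^+ k + c) by rewrite exprS; ring.
  by apply: IZ => //; apply: adjoin_x.
have lead_le k l : (k <= l)%N -> lead k `<=` lead l.
  by move=> /subnK <-; elim: (l - k)%N => // n ih b /ih /leadS.
have Iall : ideal B [set b | exists k, lead k b].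
  split.
  - by exists 0%N; case: (lead_ideal 0%N).
  - by move=> b [k []].
  - move=> a b b' Ba [k hb] [l hb']; exists (maxn k l).
    case: (lead_ideal (maxn k l)) => _ _; apply=> //.
      exact: lead_le (leq_maxl _ _) _ hb.
    exact: lead_le (leq_maxr _ _) _ hb'.
have [K hK] : exists K, forall k, lead k `<=` lead K.
  have [g [gI hg]] := nB _ Iall.
  have [K gK] : exists K, forall b, b \in g -> lead K b.
    elim: g gI {hg} => [|b g ih] gI; first by exists 0%N.
    have [K1 h1] := ih (fun y yg => gI y (mem_behead (s := b :: g) yg)).
    have [K2 h2] := gI b (mem_head _ _).
    exists (maxn K1 K2) => y; rewrite inE => /orP[/eqP ->|/h1 h].
      exact: lead_le (leq_maxr _ _) _ h2.
    exact: lead_le (leq_maxl _ _) _ h.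
  exists K => k b hb; apply: (ideal_gen_in (lead_ideal K) gK); apply: hg.
  by exists k.
pose good k (g : seq T) := forall b, lead k b ->
  exists2 c, lower k c & ideal_gen adjoin [set` g] (b * x ^+ k + c).
have goodk k : exists g : seq T, (forall y, y \in g -> I y) /\ good k g.
  have [s [sI hs]] := nB _ (lead_ideal k).
  suff [g [gI hg]] : exists g : seq T, (forall y, y \in g -> I y) /\
      forall b, b \in s -> exists2 c, lower k c & (b * x ^+ k + c) \in g.
    exists g; split=> // b /hs; elim=> [|a b' w Ba /hg[c hc cg] _ [c' hc' hw]].
      exists 0; first exact: lower0.
      by rewrite mul0r addr0; apply: ideal_gen0.
    exists (a * c + c'); first by apply: lowerD => //; apply: lowerZ.
    have -> : (a * b' + w) * x ^+ k + (a * c + c') =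
      a * (b' * x ^+ k + c) + (w * x ^+ k + c') by ring.
    by apply: ideal_genS => //; apply: sub_adjoin.
  elim: s sI {hs} => [|b s ih] sI; first by exists [::].
  have [g [gI hg]] := ih (fun y ys => sI y (mem_behead (s := b :: s) ys)).
  have [_ [c hc Ic]] := sI b (mem_head _ _).
  exists (b * x ^+ k + c :: g); split=> [y|b']; rewrite inE => /orP[/eqP ->//|].
  - exact: gI.
  - by exists c; rewrite ?mem_head.
  - by move=> /hg[c' hc' cg]; exists c'; rewrite // inE cg orbT.
have [g [gI hg]] : exists g : seq T, (forall y, y \in g -> I y) /\
    forall k, (k <= K)%N -> good k g.
  have good_sub k (g g' : seq T) : {subset g <= g'} -> good k g -> good k g'.
    move=> s h b /h[c hc hi]; exists c => //; apply: ideal_gen_sub hi => //.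
  elim: K {hK} => [|K [g [gI hg]]].
    by have [g [gI hg]] := goodk 0%N; exists g; split=> // k; rewrite leqn0 => /eqP ->.
  have [g' [g'I hg']] := goodk K.+1.
  exists (g ++ g'); split=> [y|k]; first by rewrite mem_cat => /orP[/gI|/g'I].
  rewrite leq_eqVlt => /orP[/eqP ->|].
    by apply: good_sub hg' => y yg; rewrite mem_cat yg orbT.
  by rewrite ltnS => /hg; apply: good_sub => y yg; rewrite mem_cat yg.
have goodall k : good k g.
  have [/hg//|/ltnW ltKk] := leqP k K.
  move=> b /hK /(hg K (leqnn K))[c hc hi].
  exists (x ^+ (k - K) * c); first by rewrite -(subnK ltKk) addnK; apply: lowerXn.
  have -> : b * x ^+ k + x ^+ (k - K) * c = x ^+ (k - K) * (b * x ^+ K + c).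
    by rewrite -{1}(subnK ltKk) exprD; ring.
  by apply: ideal_genZ => //; apply: subringX => //; apply: adjoin_x.
exists g; split=> // y Iy; have [k] := IB _ Iy.
elim: k y Iy => [|k ih] y Iy; first by move=> ->; apply: ideal_gen0.
move=> [b [c [Bb hc ey]]].
have [c' hc' hi] : exists2 c', lower k c' & ideal_gen adjoin [set` g] (b * x ^+ k + c').
  by apply: goodall; split=> //; exists c => //; rewrite -ey.
have e : y = (b * x ^+ k + c') + (c + -1 * c') by rewrite ey; ring.
rewrite e; apply: ideal_genD => //; apply: ih.
  have -> : c + -1 * c' = -1 * (b * x ^+ k + c') + y by rewrite ey; ring.
  apply: (IL) => //; first exact: subringN1.
  by apply: (ideal_gen_in (I := I) _ _ hi); [split|move=> w /gI].
by apply: lowerD => //; apply: lowerZ => //; apply: subringN1.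
Qed.

End Hilbert.

Lemma noetherian_generated n (zs : 'I_n -> T) :
    (forall G, subring G -> (forall i, G (zs i)) -> forall a, G a) ->
  noetherian setT.
Proof.
move=> gen.
suff [B [hB nB zB]] : exists B, [/\ subring B, noetherian B & forall i, B (zs i)].
  have -> // : setT = B by apply/seteqP; split=> // a _; apply: gen.
have : forall s : seq T, exists B, [/\ subring B, noetherian B & forall y, y \in s -> B y].
  elim=> [|y s [B [hB nB sB]]].
    exists prime_subring; split=> //; first exact: subring_prime_subring.
    exact: noetherian_prime_subring.
  exists (adjoin B y); split; [exact: subring_adjoin|exact: hilbert_basis|].
  move=> w; rewrite inE => /orP[/eqP ->|/sB]; first exact: adjoin_x.
  exact: sub_adjoin.
move=> /(_ [seq zs i | i <- enum 'I_n])[B [hB nB sB]]; exists B; split=> // i.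
by apply: sB; rewrite map_f // mem_enum.
Qed.

(** Zorn's lemma applied to the family with the empty set added, which serves as
    the union of the empty chain. *)
Lemma noetherian_max (Fam : set (set T)) : noetherian setT ->
    (forall I, Fam I -> ideal setT I) -> Fam !=set0 ->
  exists2 I, Fam I & forall J, Fam J -> I `<=` J -> J `<=` I.
Proof.
move=> nT Fid [I0 FI0].
have [G GF tot|I [[FI|I00] maxI]] := @Zorn_bigcup T (fun X => Fam X \/ X = set0).
- have [[X [GX FX]]|nX] := pselect (exists X, G X /\ Fam X); last first.
    right; apply/seteqP; split=> // y [X GX Xy].
    by case: (GF _ GX) => [FX|X0]; [case: nX; exists X|rewrite X0 in Xy].
  left; set U := \bigcup_(X in G) X.
  have XU Y : G Y -> Y `<=` U by move=> GY y Yy; exists Y.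
  have common y w : U y -> U w -> exists Y, [/\ G Y, Y y & Y w].
    move=> [Y GY Yy] [Z GZ Zw]; case: (tot _ _ GY GZ) => s.
      by exists Z; split=> //; apply: s.
    by exists Y; split=> //; apply: s.
  have FY Y y : G Y -> Y y -> Fam Y.
    by move=> GY Yy; case: (GF _ GY) => // Y0; rewrite Y0 in Yy.
  have Uid : ideal setT U.
    split=> //; first by exists X => //; case: (Fid _ FX).
    move=> a y w _ Uy Uw; have [Y [GY Yy Yw]] := common _ _ Uy Uw.
    exists Y => //; case: (Fid _ (FY _ _ GY Yy)) => _ _; exact.
  have [g [gU hg]] := nT _ Uid.
  have [Y [GY FYY gY]] : exists Y, [/\ G Y, Fam Y & forall y, y \in g -> Y y].
    elim: g gU {hg} => [|y g ih] gU; first by exists X.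
    have [Y [GY FYY gY]] := ih (fun w wg => gU w (mem_behead (s := y :: g) wg)).
    have [Z GZ Zy] := gU y (mem_head _ _).
    case: (tot _ _ GY GZ) => s.
      exists Z; split=> //; first exact: FY Zy.
      by move=> w; rewrite inE => /orP[/eqP ->//|/gY/s].
    exists Y; split=> // w; rewrite inE => /orP[/eqP ->|/gY//]; exact: s.
  have -> // : U = Y.
  apply/seteqP; split; last exact: XU.
  by move=> w /hg; apply: ideal_gen_in; [apply: Fid|].
- exists I => // J FJ IJ; apply: contrapT => nJI; apply: (maxI J); last by left.
  by split.
exfalso; apply: (maxI I0); last by left.
rewrite I00; split=> // h; have [I00' _ _] := Fid _ FI0.
exact: (h 0).
Qed.

End Noetherian.

(** * Critical subquotients *)

Lemma exprD_prime (T : comNzRingType) (p : nat) (x y : T) : prime p ->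
  exists c, (x + y) ^+ p = x ^+ p + y ^+ p + p%:R * c.
Proof.
case: p => [//|p] pp; rewrite exprDn big_ord_recl big_ord_recr /=.
rewrite /bump leq0n add1n subn0 expr0 mulr1 bin0 mulr1n binn mulr1n subnn expr0 mul1r.
exists (\sum_(i < p) x ^+ (p.+1 - (1 + i)) * y ^+ (1 + i) *+ ('C(p.+1, 1 + i) %/ p.+1)).
rewrite mulr_sumr -addrA [_ + y ^+ _]addrC; congr (_ + (_ + _)).
apply: eq_bigr => i _; rewrite mulr_natl -mulrnA divnK //.
by apply: prime_dvd_bin => //; rewrite /= add1n ltnS ltn_ord.
Qed.

Section LinearCombination.
Variables (T : comNzRingType) (P Q : set T) (act : T -> T -> T).
Hypothesis Q0 : Q 0.
Hypothesis QB : forall x y, Q x -> Q y -> Q (x - y).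
Hypothesis actDl : forall a b y, P y -> Q (act (a + b) y - (act a y + act b y)).
Hypothesis act0 : forall y, P y -> Q (act 0 y).

(** Combinations for an action that is additive in its first argument modulo [Q]
    only, so that equal generators cannot be collected by an equality. *)
Inductive act_span (gs : seq T) : set T :=
| act_span0 y of Q y : act_span gs y
| act_spanS c g y of g \in gs & act_span gs y : act_span gs (act c g + y).

Lemma act_span_sum (gs : seq T) y : (forall g, g \in gs -> P g) -> act_span gs y ->
  exists c : 'I_(size gs) -> T, Q (y - \sum_i act (c i) gs`_i).
Proof.
move=> gP.
have QN x : Q x -> Q (- x).
  by move=> Qx; rewrite -sub0r; apply: QB.
have QD x z : Q x -> Q z -> Q (x + z).
  by move=> Qx Qz; rewrite -[z]opprK; apply: QB => //; apply: QN.
elim=> [z Qz|a g z gg _ [c hc]].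
  exists (fun=> 0); apply: QB => //; apply: big_ind => // i _.
  exact/act0/gP/mem_nth.
have ig : (index g gs < size gs)%N by rewrite index_mem.
pose j := Ordinal ig; have gj : gs`_j = g by rewrite /= nth_index.
exists (fun i => if i == j then a + c i else c i).
rewrite (bigD1 j) //= eqxx nth_index // (eq_bigr (fun i : 'I__ => act (c i) gs`_i)); last first.
  by move=> i /negPf ->.
move: hc; rewrite (bigD1 j) //= nth_index // => hc.
have h := actDl a (c j) (gP _ gg).
have := QB hc h; congr Q; ring.
Qed.

End LinearCombination.

Section Devissage.
Variables (T : comNzRingType) (n : nat) (zs : 'I_n -> T).
Hypothesis zs_gen : forall G, subring G -> (forall i, G (zs i)) -> forall a, G a.
Variables (L : set (T -> T)) (Q0 : set T).
Hypothesis Ladd : forall d, L d -> additive_map d.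
Hypothesis LM : forall d, L d -> leibniz d.
Hypothesis Lcomm : forall d e, L d -> L e -> L (comm d e).
Hypothesis Q0id : ideal setT Q0.
Hypothesis Q0L : forall d y, L d -> Q0 y -> Q0 (d y).
Hypothesis Lnil : forall d y, L d -> exists k, Q0 (iter k d y).

Definition stable_ideal I := [/\ ideal setT I, Q0 `<=` I & forall d y, L d -> I y -> I (d y)].

Definition colon (Q P : set T) : set T := [set a | forall y, P y -> Q (a * y)].

Lemma idealB (I : set T) x y : ideal setT I -> I x -> I y -> I (x - y).
Proof. by move=> [_ _ IL] Ix Iy; rewrite addrC -mulN1r; apply: IL. Qed.

Lemma idealD (I : set T) x y : ideal setT I -> I x -> I y -> I (x + y).
Proof. by move=> [_ _ IL] Ix Iy; rewrite -[x]mul1r; apply: IL. Qed.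

Lemma idealL (I : set T) a x y : ideal setT I -> I x -> I y -> I (a * x + y).
Proof. by move=> [_ _ IL]; apply: IL. Qed.

Lemma idealZ (I : set T) a x : ideal setT I -> I x -> I (a * x).
Proof. by move=> [I0 _ IL] Ix; rewrite -[_ * _]addr0; apply: IL. Qed.

Lemma colon_ideal Q P : ideal setT Q -> ideal setT (colon Q P).
Proof.
move=> hQ; split=> //; first by move=> y _; rewrite mul0r; case: hQ.
move=> a x y _ hx hy w Pw; rewrite mulrDl -mulrA.
by apply: idealD => //; [apply: idealZ => //; apply: hx|apply: hy].
Qed.

Lemma deriv_expn d a k : L d -> d (a ^+ k) * a = k%:R * a ^+ k * d a.
Proof.
move=> Ld; elim: k => [|k ih]; first by rewrite expr0 (leibniz1 (LM Ld)) !mul0r.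
by rewrite exprS LM // mulrDl -[a * d _ * a]mulrA ih -addn1 natrD; ring.
Qed.

Lemma deriv_expS d a k : L d -> d (a ^+ k.+1) = k.+1%:R * a ^+ k * d a.
Proof.
move=> Ld; elim: k => [|k ih]; first by rewrite expr1 expr0 !mul1r.
by rewrite exprS LM // ih -(addn1 k.+1) natrD [a ^+ k.+1]exprS; ring.
Qed.

Lemma deriv_nat d k : L d -> d k%:R = 0.
Proof.
move=> Ld; elim: k => [|k ih]; first by rewrite additive_map0 //; apply: Ladd.
by rewrite -addn1 natrD Ladd // ih add0r (leibniz1 (LM Ld)).
Qed.

Let noethT : noetherian [set: T].
Proof. exact: noetherian_generated zs_gen. Qed.

(** A subquotient [P / Q] whose annihilator [q] is maximal among the annihilators
    of its nonzero stable submodules: the analogue, for modules with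
    derivations, of a cyclic module [A / p] with [p] an associated prime. *)
Section Critical.
Variables (P Q : set T).
Let q := colon Q P.
Hypothesis QLid : stable_ideal Q.
Hypothesis PLid : stable_ideal P.
Hypothesis QP : Q `<=` P.
Hypothesis nPQ : ~ (P `<=` Q).
Hypothesis qmax : forall P', stable_ideal P' -> P' `<=` P -> Q `<=` P' -> ~ (P' `<=` Q) ->
  colon Q P' `<=` q.

Let Qid : ideal setT Q. Proof. by case: QLid. Qed.
Let Pid : ideal setT P. Proof. by case: PLid. Qed.
Let QL d y : L d -> Q y -> Q (d y). Proof. by case: QLid => _ _; apply. Qed.
Let PL d y : L d -> P y -> P (d y). Proof. by case: PLid => _ _; apply. Qed.
Let qid : ideal setT q. Proof. exact: colon_ideal. Qed.
Let Q00 : Q 0. Proof. by case: Qid. Qed.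
Let P00 : P 0. Proof. by case: Pid. Qed.
Let Q0Q : Q0 `<=` Q. Proof. by case: QLid. Qed.

Let qL d a : L d -> q a -> q (d a).
Proof.
move=> Ld qa y Py; have -> : d a * y = d (a * y) - a * d y by rewrite LM // addrK.
by apply: idealB => //; [apply/QL/qa|apply/qa/PL].
Qed.

Let qD x y : q x -> q y -> q (x + y). Proof. by move=> qx qy; exact: (idealD qid qx qy). Qed.
Let qZ a x : q x -> q (a * x). Proof. by move=> qx; exact: (idealZ a qid qx). Qed.

Let q1 : ~ q 1.
Proof. by move=> h; apply: nPQ => y /h; rewrite mul1r. Qed.

Let max_elim (P' : set T) a : stable_ideal P' -> P' `<=` P -> Q `<=` P' ->
  (forall y, P' y -> Q (a * y)) -> ~ q a -> P' `<=` Q.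
Proof. by move=> h1 h2 h3 h4 nqa; apply: contrapT => h5; apply/nqa/(qmax h1 h2 h3 h5). Qed.

(** The kernel of a constant [c] modulo [q] is stable under [L]; were it nonzero,
    its annihilator would contain [c] and thus be larger than [q]. *)
Let const_regular c y : (forall d, L d -> q (d c)) -> ~ q c -> P y -> Q (c * y) -> Q y.
Proof.
move=> dc nqc Py Qcy.
pose P' : set T := [set y | P y /\ Q (c * y)].
suff : P' `<=` Q by apply.
apply: (max_elim (a := c)) => //.
- split.
  + split=> //; first by split=> //; rewrite mulr0.
    move=> a x w _ [Px Qx] [Pw Qw]; split; first exact: idealL.
    by rewrite mulrDr mulrCA; apply: idealL.
  + by move=> w /Q0Q Qw; split; [apply: QP|apply: idealZ].
  + move=> d w Ld [Pw Qw]; split; first exact: PL.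
    have -> : c * d w = d (c * w) - d c * w by rewrite LM // addrC addKr.
    by apply: idealB => //; [apply: QL|apply: dc].
- by move=> w [].
- by move=> w Qw; split; [apply: QP|apply: idealZ].
- by move=> w [].
Qed.

Let nat_regular k y : ~ q k%:R -> P y -> Q (k%:R * y) -> Q y.
Proof.
move=> nqk; apply: const_regular => // d Ld; rewrite deriv_nat //.
by case: qid.
Qed.

Let LnilQ d y : L d -> P y -> exists k, Q (iter k d y).
Proof. by move=> Ld _; have [k h] := Lnil y Ld; exists k; apply: Q0Q. Qed.

Let Lgen (G : set T) : G 1 -> (forall x y, G x -> G y -> G (x - y)) ->
  (forall x y, G x -> G y -> G (x * y)) -> (forall i, G (zs i)) -> forall a, G a.
Proof. by move=> G1 GB GM; apply: zs_gen. Qed.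

Section CharacteristicP.
Variable p : nat.
Hypothesis pp : prime p.
Hypothesis qp : q p%:R.

Let frob_span (ms : seq T) := act_span q (fun a y => a ^+ p * y) ms.

Let frob_spanD ms x y : frob_span ms x -> frob_span ms y -> frob_span ms (x + y).
Proof.
elim=> [{}x qx|c g {}x gg _ ih] hy; last by rewrite -addrA; apply: act_spanS => //; apply: ih.
elim: hy => [{}y qy|c g {}y gg _ ih]; first by apply: act_span0; apply: qD.
by rewrite addrCA; apply: act_spanS.
Qed.

Let frob_span_map (ms ms' : seq T) w : (forall c m, m \in ms -> frob_span ms' (w * (c ^+ p * m))) ->
  forall x, frob_span ms x -> frob_span ms' (w * x).
Proof.
move=> h x; elim=> [{}x qx|c g {}x gg _ ih]; first by apply: act_span0; apply: qZ.
by rewrite mulrDr; apply: frob_spanD => //; apply: h.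
Qed.

(** Monomials in the generators with exponents less than [p] span the ring over the
    [p]-th powers, modulo [q]. *)
Let finite_over_frobenius : exists ms : seq T, forall a, frob_span ms a.
Proof.
suff [ms [h1 hz]] : exists ms, frob_span ms 1 /\
    forall i x, frob_span ms x -> frob_span ms (zs i * x).
  exists ms => a; rewrite -[a]mulr1.
  apply: (Lgen (G := [set a | forall x, frob_span ms x -> frob_span ms (a * x)])) h1 => //=.
  - by move=> x; rewrite mul1r.
  - move=> x y hx hy w hw; rewrite mulrBl -mulrN; apply: frob_spanD; first exact: hx.
    apply: hy; rewrite -mulN1r; apply: (frob_span_map (ms := ms)) hw => c m mm.
    have := exprD_prime 1 (-1 : T) pp => -[e]; rewrite subrr expr0n expr1n.
    have p0 : p != 0%N by case: p pp.
    rewrite (negPf p0) => he.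
    have eN : -1 = (-1) ^+ p + p%:R * e.
      by apply: (addrI 1); rewrite addrA -he subrr.
    have -> : -1 * (c ^+ p * m) = (- c) ^+ p * m + p%:R * (e * (c ^+ p * m)).
      by rewrite {1}eN [(- c) ^+ p]exprNn; ring.
    apply: act_spanS => //; apply: act_span0; rewrite mulrC; exact: qZ.
  - by move=> x y hx hy w hw; rewrite -mulrA; apply/hx/hy.
have main : forall s : seq T, exists ms, frob_span ms 1 /\
    forall z x, z \in s -> frob_span ms x -> frob_span ms (z * x).
  elim=> [|z s [ms [h1 hs]]].
    exists [:: 1]; split=> //.
    suff : frob_span [:: 1] (1 ^+ p * 1 + 0) by rewrite expr1n mulr1 addr0.
    by apply: act_spanS; rewrite ?mem_head //; apply: act_span0; case: qid.
  pose ms' := [seq z ^+ j * m | j <- iota 0 p, m <- ms].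
  have ms'in j m : (j < p)%N -> m \in ms -> z ^+ j * m \in ms'.
    by move=> jp mm; apply: allpairs_f => //; rewrite mem_iota.
  have single c m : m \in ms' -> frob_span ms' (c ^+ p * m).
    move=> mm; rewrite -[X in frob_span _ X]addr0; apply: act_spanS => //.
    by apply: act_span0; case: qid.
  have zj j x : (j < p)%N -> frob_span ms x -> frob_span ms' (z ^+ j * x).
    move=> jp; apply: frob_span_map => c m mm; rewrite mulrCA.
    by apply: single; apply: ms'in.
  exists ms'; split.
    by have := zj 0%N 1 (prime_gt0 pp) h1; rewrite expr0 mul1r.
  move=> z' x; rewrite inE => /orP[/eqP -> {z'}|z's].
    apply: frob_span_map => c _ /allpairsP[[j m] /= [jp mm ->]].
    rewrite mem_iota add0n /= in jp.
    have [jp'|pj] := ltnP j.+1 p.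
      have -> : z * (c ^+ p * (z ^+ j * m)) = c ^+ p * (z ^+ j.+1 * m).
        by rewrite exprS; ring.
      by apply: single; apply: ms'in.
    have jp1 : j.+1 = p by apply/eqP; rewrite eqn_leq pj jp.
    have -> : z * (c ^+ p * (z ^+ j * m)) = (c * z) ^+ p * (z ^+ 0 * m).
      by rewrite exprMn -[in z ^+ p]jp1 exprS expr0; ring.
    by apply: single; apply: ms'in => //; apply: prime_gt0.
  apply: frob_span_map => c _ /allpairsP[[j m] /= [jp mm ->]].
  rewrite mem_iota add0n /= in jp.
  have -> : z' * (c ^+ p * (z ^+ j * m)) = z ^+ j * (z' * (c ^+ p * m)) by ring.
  apply: zj => //; apply: hs => //; rewrite -[X in frob_span _ X]addr0.
  by apply: act_spanS => //; apply: act_span0; case: qid.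
have [ms [h1 hs]] := main [seq zs i | i <- enum 'I_n].
exists ms; split=> // i x; apply: hs; by rewrite map_f // mem_enum.
Qed.

(** All [p]-th powers are constants modulo [q], so [L] acts linearly over them: the
    Frobenius turns [P / Q] into a module of finite type over a domain on
    which all derivations vanish. *)
Lemma engel_characteristic_p y : P y -> tnil app L Q y.
Proof.
have p0 : (0 < p)%N := prime_gt0 pp.
have frobD a b : q ((a + b) ^+ p - (a ^+ p + b ^+ p)).
  have [c ->] := exprD_prime a b pp; rewrite addrC addKr mulrC; exact: qZ.
have dfrob d a : L d -> q (d (a ^+ p)).
  move=> Ld; rewrite -(prednK p0) deriv_expS // (prednK p0) -mulrA mulrC.
  exact: qZ.
pose q' : set T := [set a | q (a ^+ p)].
have q'lin a x z : q' x -> q' z -> q' (a * x + z).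
  move=> qx qz; have := qD (frobD (a * x) z) (qD (qZ (a ^+ p) qx) qz).
  by rewrite /q' /= exprMn subrK.
have q'0 : q' 0 by rewrite /q' /= expr0n gtn_eqF //; case: qid.
have q'1 : ~ q' 1 by rewrite /q' /= expr1n.
have q'prime x z : q' (x * z) -> q' x \/ q' z.
  rewrite /q' /= exprMn => h; apply: contrapT => /not_orP[nx nz].
  apply: nz => w Pw; apply: (const_regular (c := x ^+ p)) => //.
  - by move=> d; apply: dfrob.
  - exact: idealZ.
  - by rewrite mulrA; apply: h.
have [F [pi [pi0 pifrac]]] := residue_field q'lin q'0 q'1 q'prime.
pose act (a y : T) : T := a ^+ p * y.
have actDl a b w : P w -> Q (act (a + b) w - (act a w + act b w)).
  by move=> Pw; rewrite /act -mulrDl -mulrBl; apply: frobD.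
have act0 w : P w -> Q (act 0 w).
  by move=> _; rewrite /act expr0n gtn_eqF // mul0r.
have [g [gP hg]] := noethT Pid.
have [ms hms] := finite_over_frobenius.
pose gs := [seq m * x | m <- ms, x <- g].
have gsP x : x \in gs -> P x.
  by move=> /allpairsP[[m w] [_ /gP Pw ->]]; apply: idealZ.
have spanD x w : act_span Q act gs x -> act_span Q act gs w -> act_span Q act gs (x + w).
  elim=> [{}x Qx|c m {}x gg _ ih] hy; last by rewrite -addrA; apply: act_spanS => //; apply: ih.
  elim: hy => [{}w Qw|c m {}w gg _ ih]; first by apply: act_span0; apply: idealD.
  by rewrite addrCA; apply: act_spanS.
have Pspan w : P w -> act_span Q act gs w.
  move=> /hg; elim=> [|a x {}w _ xg _ ih]; first exact: act_span0.
  apply: spanD => //; elim: (hms a) => [{}a qa|c m {}a mm _ ih'].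
    by apply: act_span0; apply: qa; apply: gP.
  rewrite mulrDl -mulrA; apply: act_spanS => //.
  exact: allpairs_f.
have gsum w : P w -> exists c : 'I_(size gs) -> T, Q (w - \sum_i act (c i) gs`_i).
  move=> Pw; apply: (act_span_sum (P := P)) => //; first by move=> *; apply: idealB.
  exact: Pspan.
apply: (@localized_engel T P Q q' act _ _ _ _ _ _ _ _ _ _ _ _ _ _ _
  (size gs) (fun i => gs`_i) _ _ F pi pi0 pifrac L (fun _ _ => 0) n zs) => //.
- by move=> *; apply: idealB.
- by move=> *; apply: idealB.
- by move=> a x z; rewrite /act mulrDr.
- by move=> a x Px; apply: idealZ.
- by move=> a x Qx; apply: idealZ.
- by move=> a b x _; rewrite /act exprMn mulrA subrr.
- by move=> x _; rewrite /act expr1n mul1r subrr.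
- move=> a x Px Qx; have [qa|nqa] := pselect (q (a ^+ p)); [by left|right].
  by apply: (const_regular (c := a ^+ p)) => // d; apply: dfrob.
- by move=> a x qa Px; apply: qa.
- by move=> i; apply/gsP/mem_nth.
- by move=> d _ a b; rewrite addr0.
- by move=> d _ a b; rewrite mul0r mulr0 addr0.
- move=> d a x Ld Px; rewrite /act expr0n gtn_eqF // mul0r add0r LM // addrK.
  exact: dfrob.
- by move=> d e a _ _; rewrite /comm subrr.
Qed.

End CharacteristicP.

Section CharacteristicZero.
Hypothesis char0 : forall k, ~ q k.+1%:R.

Let nat_regular_q k a : q (k.+1%:R * a) -> q a.
Proof.
move=> h y Py; apply: (nat_regular (char0 (k := k))); first exact: idealZ.
by rewrite mulrA; apply: h.
Qed.

(** The prime [p] associated with [P / Q] is nilpotent modulo [q], because the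
    elements killed by powers of [p] form a stable submodule.  Without torsion
    the radical of a stable ideal is stable, so the elements killed by [p] are
    also a stable submodule, whence [p = q].  The torsion elements over the
    domain [T / q] are stable too, and must vanish. *)
Lemma engel_characteristic_0 y : P y -> tnil app L Q y.
Proof.
have /existsNP[x0 /not_implyP[Px0 nQx0]] := nPQ.
pose ann (x : T) : set T := [set a | Q (a * x)].
have annid x : ideal setT (ann x).
  split=> //; first by rewrite /ann /= mul0r.
  move=> a u v _ hu hv; rewrite /ann /= mulrDl -mulrA.
  by apply: idealD => //; apply: idealZ.
have [p [y0 [Py0 nQy0 pE]] pmax] : exists2 p,
    exists y0, [/\ P y0, ~ Q y0 & p = ann y0] &
    forall J, (exists y0, [/\ P y0, ~ Q y0 & J = ann y0]) -> p `<=` J -> J `<=` p.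
  apply: (noetherian_max (Fam := [set p | exists y0, [/\ P y0, ~ Q y0 & p = ann y0]])) => //.
    by move=> _ [x [_ _ ->]].
  by exists (ann x0), x0.
have pid : ideal setT p by rewrite pE.
have pprime a b : p (a * b) -> p a \/ p b.
  move=> hab; apply: contrapT => /not_orP[na nb]; apply: na.
  apply: (pmax (ann (b * y0))).
  - exists (b * y0); split=> //; first exact: idealZ.
    by move: nb; rewrite pE.
  - by move=> c; rewrite pE /ann /= => Qc; rewrite mulrCA; apply: idealZ.
  - by move: hab; rewrite pE /ann /= -mulrA.
have p1 : ~ p 1 by rewrite pE /ann /= mul1r.
have pX a k : p (a ^+ k) -> p a.
  elim: k => [|k ih]; first by rewrite expr0 => /p1.
  by rewrite exprS => /pprime[].
have qp : q `<=` p by move=> a qa; rewrite pE; apply: qa.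
pose P1 : set T := [set w | P w /\ forall a, p a -> exists k, Q (a ^+ k * w)].
have up a w k l : (k <= l)%N -> Q (a ^+ k * w) -> Q (a ^+ l * w).
  by move=> /subnK <- h; rewrite exprD -mulrA; apply: idealZ.
have P1id : stable_ideal P1.
  split.
  - split=> //; first by split=> // a _; exists 0%N; rewrite mulr0.
    move=> b x w _ [Px hx] [Pw hw]; split; first exact: idealL.
    move=> a pa; have [k hk] := hx a pa; have [l hl] := hw a pa.
    exists (maxn k l); rewrite mulrDr mulrCA; apply: idealD => //.
      by apply: idealZ => //; apply: up hk; apply: leq_maxl.
    by apply: up hl; apply: leq_maxr.
  - move=> w /Q0Q Qw; split; first exact: QP.
    by move=> a _; exists 0%N; rewrite expr0 mul1r.
  - move=> d w Ld [Pw hw]; split; first exact: PL.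
    move=> a pa; have [k hk] := hw a pa; exists k.+1.
    have -> : a ^+ k.+1 * d w = d (a ^+ k.+1 * w) - (k.+1%:R * d a) * (a ^+ k * w).
      by rewrite LM // deriv_expS //; ring.
    apply: idealB => //; last exact: idealZ.
    by apply: QL => //; apply: up hk.
have nilp a : p a -> exists k, q (a ^+ k).
  move=> pa; have [P1i _ _] := P1id; have [g [gP1 hg]] := noethT P1i.
  have [k hk] : exists k, forall w, w \in g -> Q (a ^+ k * w).
    elim: g gP1 {hg} => [|w g ih] gP1; first by exists 0%N.
    have [k hk] := ih (fun v vg => gP1 v (mem_behead (s := w :: g) vg)).
    have [l hl] := (gP1 w (mem_head _ _)).2 a pa.
    exists (maxn k l) => v; rewrite inE => /orP[/eqP ->|/hk h].
      by apply: up hl; apply: leq_maxr.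
    by apply: up h; apply: leq_maxl.
  exists k; apply: (qmax P1id) => [w []//|w Qw||w].
  - by split; [apply: QP|move=> b _; exists 0%N; rewrite expr0 mul1r].
  - by move=> h; apply/nQy0/h; split=> // b; rewrite pE => hb; exists 1%N; rewrite expr1.
  move=> /hg; elim=> [|b v {}w _ vg _ ih]; first by rewrite mulr0.
  by rewrite mulrDr mulrCA; apply: idealD => //; apply: idealZ => //; apply: hk.
have pL d a : L d -> p a -> p (d a).
  move=> Ld /nilp[k hk]; set b := d a.
  suff [l /qp/pX//] : exists l, q (b ^+ l).
  (* Deriving [a ^ (j + 1) * b ^ m] and multiplying by [b] trades one factor [a]
     for two factors [b], up to an integer factor. *)
  suff key j m : q (a ^+ j * b ^+ m) -> q (b ^+ (m + j.*2)).
    by exists (0 + k.*2)%N; apply: key; rewrite mulr1.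
  elim: j m => [|j ih] m; first by rewrite expr0 mul1r addn0.
  move=> h; rewrite doubleS !addnS -!addSn; apply: ih.
  apply: (nat_regular_q (k := j)).
  have := qL Ld h; rewrite LM // deriv_expS // -/b => /(qZ b) h1.
  have := qZ (m%:R * d b) h => h2.
  have := idealB qid h1 h2; congr q.
  have e := deriv_expn b m Ld.
  have -> : b * (j.+1%:R * a ^+ j * b * b ^+ m + a ^+ j.+1 * d (b ^+ m)) =
    j.+1%:R * (a ^+ j * b ^+ m.+2) + a ^+ j.+1 * (d (b ^+ m) * b).
    by rewrite !exprS; ring.
  by rewrite e; ring.
have pq : p `<=` q.
  pose P2 : set T := [set w | P w /\ forall a, p a -> Q (a * w)].
  move=> a pa; apply: (qmax (P' := P2)) => //.
  - split.
    + split=> //; first by split=> // b _; rewrite mulr0.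
      move=> b x w _ [Px hx] [Pw hw]; split; first exact: idealL.
      move=> c pc; rewrite mulrDr mulrCA.
      by apply: idealD => //; [apply: idealZ => //; apply: hx|apply: hw].
    + by move=> w /Q0Q Qw; split; [apply: QP|move=> b _; apply: idealZ].
    + move=> d w Ld [Pw hw]; split; first exact: PL.
      move=> b pb; have -> : b * d w = d (b * w) - d b * w by rewrite LM // addrC addKr.
      by apply: idealB => //; [apply/QL/hw|apply/hw/pL].
  - by move=> w [].
  - by move=> w Qw; split; [apply: QP|move=> b _; apply: idealZ].
  - by move=> h; apply/nQy0/h; split=> // b; rewrite pE.
  - by move=> w [_]; apply.
have qprime a b : q (a * b) -> q a \/ q b.
  by move=> /qp/pprime[/pq|/pq]; [left|right].
have torsion_free a w : P w -> Q (a * w) -> q a \/ Q w.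
  move=> Pw Qaw; have [qa|nqa] := pselect (q a); [by left|right].
  pose P3 : set T := [set w | P w /\ exists a, ~ q a /\ Q (a * w)].
  have qM b c : ~ q b -> ~ q c -> ~ q (b * c) by move=> nb nc /qprime[].
  have P3id : stable_ideal P3.
    split.
    - split=> //; first by split=> //; exists 1; rewrite mulr0.
      move=> b x v _ [Px [c [qc hc]]] [Pv [e [qe he]]]; split.
        exact: idealL.
      exists (c * e); split; first exact: qM.
      have -> : c * e * (b * x + v) = (e * b) * (c * x) + c * (e * v) by ring.
      by apply: idealD => //; apply: idealZ.
    - by move=> v /Q0Q Qv; split; [apply: QP|exists 1; split=> //; apply: idealZ].
    - move=> d v Ld [Pv [c [qc hc]]]; split; first exact: PL.
      exists (c * c); split; first exact: qM.
      have -> : c * c * d v = c * d (c * v) - d c * (c * v) by rewrite LM //; ring.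
      by apply: idealB => //; apply: idealZ => //; apply: QL.
  have [P3i _ _] := P3id; have [g [gP3 hg]] := noethT P3i.
  have [b [qb hb]] : exists b, ~ q b /\ forall v, v \in g -> Q (b * v).
    elim: g gP3 {hg} => [|v g ih] gP3; first by exists 1.
    have [b [qb hb]] := ih (fun u ug => gP3 u (mem_behead (s := v :: g) ug)).
    have [_ [c [qc hc]]] := gP3 v (mem_head _ _).
    exists (b * c); split; first exact: qM.
    move=> u; rewrite inE => /orP[/eqP ->|/hb h].
      by rewrite -mulrA; apply: idealZ.
    by rewrite [b * c]mulrC -mulrA; apply: idealZ.
  suff : P3 `<=` Q by apply; split=> //; exists a.
  apply: (max_elim (a := b)) => //.
  - by move=> v [].
  - by move=> v Qv; split; [apply: QP|exists 1; split=> //; apply: idealZ].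
  move=> v /hg; elim=> [|c u {}v _ ug _ ih]; first by rewrite mulr0.
  by rewrite mulrDr mulrCA; apply: idealD => //; apply: idealZ => //; apply: hb.
have qlin a x w : q x -> q w -> q (a * x + w) by case: qid => _ _ h; apply: h.
have q00 : q 0 by case: qid.
have [F [pi [pi0 pifrac]]] := residue_field qlin q00 q1 qprime.
have [gs [gsP hgs]] := noethT Pid.
have gsum w : P w -> exists c : 'I_(size gs) -> T, Q (w - \sum_i c i * gs`_i).
  move=> Pw; apply: (act_span_sum (P := P) (act := *%R)) => //.
  - by move=> *; apply: idealB.
  - by move=> a b v _; rewrite mulrDl subrr.
  move: (hgs _ Pw) => {Pw}; elim=> [|a x {}w _ xg _ ih]; first exact: act_span0.
  exact: act_spanS.
apply: (@localized_engel T P Q q *%R _ _ _ _ _ _ _ _ _ _ _ _ _ _ _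
  (size gs) (fun i => gs`_i) _ _ F pi pi0 pifrac L (fun d => d) n zs) => //.
- by move=> *; apply: idealB.
- by move=> *; apply: idealB.
- by move=> a x z; rewrite mulrDr.
- by move=> a x Px; apply: idealZ.
- by move=> a x Qx; apply: idealZ.
- by move=> a b x _; rewrite mulrDl subrr.
- by move=> a b x _; rewrite mulrA subrr.
- by move=> x _; rewrite mul1r subrr.
- by move=> a x qa Px; apply: qa.
- by move=> i; apply/gsP/mem_nth.
- by move=> d a x Ld Px; rewrite LM // subrr.
Qed.

End CharacteristicZero.

(** If an integer annihilates [P / Q], the least one is a prime, as integers are
    constants. *)
Lemma engel_critical y : P y -> tnil app L Q y.
Proof.
have [|nex] := boolP `[< exists k, (fun k => `[< (0 < k)%N /\ q k%:R >]) k >]; last first.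
  apply: engel_characteristic_0 => k hk.
  by case/asboolP: nex; exists k.+1; apply/asboolP.
move=> /asboolP ex; case: (ex_minnP ex) => p /asboolP[p0 qp] pmin.
apply: (engel_characteristic_p (p := p)) => //.
have notq k : (0 < k < p)%N -> ~ q k%:R.
  move=> /andP[k0 kp] qk; have : (p <= k)%N by apply: pmin; apply/asboolP.
  by rewrite leqNgt kp.
have p1 : (1 < p)%N.
  by rewrite ltn_neqAle p0 andbT; apply/eqP => p1; apply: q1; rewrite -p1 in qp.
apply/primeP; split=> // d /dvdnP[e pE].
have e0 : (0 < e)%N by move: p0; rewrite pE muln_gt0 => /andP[].
have d0 : (0 < d)%N by move: p0; rewrite pE muln_gt0 => /andP[].
apply: contrapT => /negP; rewrite negb_or => /andP[/eqP d1 /eqP dp].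
have dp' : (d < p)%N.
  by rewrite ltn_neqAle; apply/andP; split; [apply/eqP|rewrite pE leq_pmull].
have ep : (e < p)%N.
  rewrite pE; apply: ltn_Pmulr => //; rewrite ltn_neqAle d0 andbT.
  by apply/eqP => h; apply: d1.
apply: nPQ => w Pw.
apply: (nat_regular (notq d _)) => //; first by rewrite d0.
apply: (nat_regular (notq e _)); [by rewrite e0|exact: idealZ|].
by rewrite mulrA -natrM -pE; apply: qp.
Qed.

End Critical.

(** Take [Q] maximal such that the action modulo [Q] is not nilpotent; then no
    stable [P] larger than [Q] can be nilpotent modulo [Q], and a critical one
    contradicts this. *)
Theorem engel_derivations y : tnil app L Q0 y.
Proof.
apply: contrapT => nty.
pose FamQ : set (set T) := [set Q | stable_ideal Q /\ exists y, ~ tnil app L Q y].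
have [Q [QLid [y1 nty1]] Qmax] : exists2 Q, FamQ Q & forall J, FamQ J -> Q `<=` J -> J `<=` Q.
  apply: noetherian_max => //; first by move=> I [[]].
  by exists Q0; split; [split|exists y].
pose FamP : set (set T) :=
  [set q | exists P, [/\ stable_ideal P, Q `<=` P, ~ (P `<=` Q) & q = colon Q P]].
have [_ [P [PLid QP nPQ ->]] qmax] : exists2 q, FamP q & forall J, FamP J -> q `<=` J -> J `<=` q.
  have Qid : ideal setT Q by case: QLid.
  apply: noetherian_max => //; first by move=> _ [P [_ _ _ ->]]; apply: colon_ideal.
  exists (colon Q setT), setT; split=> // h.
  by apply: nty1; apply: tnil_base; apply: h.
have Pt : forall y, P y -> tnil app L Q y.
  apply: engel_critical => // P' P'L P'P QP' nP'Q.
  apply: qmax; first by exists P'.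
  by move=> a ha w /P'P; apply: ha.
apply: nPQ; apply: (Qmax P) => //; split=> //.
exists y1 => h; apply: nty1; exact: tnil_trans Pt h.
Qed.

End Devissage.

(** * Words in derivations and nilpotent Lie algebras *)

Lemma mpoly_int_generated n (G : set {mpoly int[n]}) :
  subring G -> (forall i, G 'X_i) -> forall p, G p.
Proof.
move=> hG GX p; have [G1 GB GM] := hG; have G0 := subring0 hG.
have GD x y : G x -> G y -> G (x + y) by apply: subringD.
have GN x : G x -> G (- x) by move=> Gx; rewrite -sub0r; apply: GB.
rewrite (mpolyE p); apply: (big_ind G) => // m _.
rewrite -mul_mpolyC; apply: (GM).
  have Gnat k : G ((k%:Z)%:MP).
    by elim: k => // k ih; rewrite -addn1 PoszD mpolyCD; apply: GD.
  by move: (mcoeff m p) => [k|k]; rewrite ?NegzE ?mpolyCN; [|apply: GN]; apply: Gnat.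
rewrite mpolyXE_id; apply: (big_ind G) => // i _.
exact: subringX.
Qed.

Section WordLength.
Variables (V : zmodType) (m : nat) (t : 'I_m -> V -> V).

Fixpoint killed k : set V :=
  if k is k'.+1 then [set a | forall j, killed k' (t j a)] else [set 0].

Hypothesis tD : forall j, additive_map (t j).

Lemma killed0 k : killed k 0.
Proof. by elim: k => // k ih j; rewrite additive_map0. Qed.

Lemma killedS k : killed k `<=` killed k.+1.
Proof.
elim: k => [a -> j|k ih a ha j]; first by rewrite additive_map0.
exact/ih/ha.
Qed.

Lemma killed_le k l : (k <= l)%N -> killed k `<=` killed l.
Proof. by move=> /subnK <-; elim: (l - k)%N => // i ih a /ih /killedS. Qed.

Lemma killedD k a b : killed k a -> killed k b -> killed k (a + b).
Proof.
elim: k a b => [a b -> ->|k ih a b ha hb j]; first by rewrite /= addr0.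
by rewrite tD; apply: ih.
Qed.
End WordLength.

Inductive ring_gen (A : comPzRingType) (S : set A) : set A :=
| ring_gen_in a of S a : ring_gen S a
| ring_gen1 : ring_gen S 1
| ring_genB a b of ring_gen S a & ring_gen S b : ring_gen S (a - b)
| ring_genM a b of ring_gen S a & ring_gen S b : ring_gen S (a * b).

(** Polynomial rings have derivations with arbitrary values at the variables. *)
Lemma lift_to_polynomials (A : comNzRingType) n (x : 'I_n -> A)
    (eta : {rmorphism {mpoly int[n]} -> A}) (d : A -> A) :
    (forall i, eta 'X_i = x i) -> additive_map d -> leibniz d ->
    (forall i, ring_gen (range x) (d (x i))) ->
  exists D : {mpoly int[n]} -> {mpoly int[n]},
    [/\ additive_map D, leibniz D & forall p, eta (D p) = d (eta p)].
Proof.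
move=> etaX dD dM dx.
have lift a : ring_gen (range x) a -> exists p, eta p = a.
  elim=> [_ [i _ <-]| |b c _ [p <-] _ [q <-]|b c _ [p <-] _ [q <-]].
  - by exists 'X_i.
  - by exists 1; rewrite rmorph1.
  - by exists (p - q); rewrite rmorphB.
  - by exists (p * q); rewrite rmorphM.
have /choice[P hP] : forall i, exists p, eta p = d (x i) by move=> i; apply: lift.
pose D (p : {mpoly int[n]}) := \sum_i P i * p^`M(i).
have DD : additive_map D.
  move=> p q; rewrite /D -big_split /=; apply: eq_bigr => i _.
  by rewrite mderivD mulrDr.
have DM : leibniz D.
  move=> p q; rewrite /D mulr_suml mulr_sumr -big_split /=; apply: eq_bigr => i _.
  by rewrite mderivM; ring.
have D1 := leibniz1 DM; have d1 := leibniz1 dM.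
have DX i : D 'X_i = P i.
  rewrite /D (bigD1 i) //= mderivX mnm1E eqxx scale1r big1 ?addr0.
    have -> : (U_(i) - U_(i))%MM = 0%MM by apply/mnmP => j; rewrite !mnmE subnn.
    by rewrite mpolyX0 mulr1.
  by move=> j /negPf ne; rewrite mderivX mnm1E eq_sym ne scale0r mulr0.
exists D; split=> // p.
apply: (mpoly_int_generated (G := [set p | eta (D p) = d (eta p)])) => /=.
- split=> /=.
  + by rewrite D1 rmorph1 rmorph0 d1.
  + by move=> u v hu hv; rewrite (additive_mapB _ _ DD) !rmorphB hu hv additive_mapB.
  + by move=> u v hu hv; rewrite DM rmorphD !rmorphM hu hv dM.
- by move=> i; rewrite DX hP etaX.
Qed.

(** All derivations in [H] that lift are lifted, not only the [t j]: the set of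
    lifts is closed under brackets, and locally nilpotent modulo the kernel of
    [eta].  As the family [t] is finite, nilpotency at [x i] gives a bound on
    the length of the words by induction, which is Koenig's lemma. *)
Lemma engel_words (A : comNzRingType) n (x : 'I_n -> A) (H : set (A -> A))
    (m : nat) (t : 'I_m -> A -> A) :
    (forall d, H d -> additive_map d) ->
    (forall d, H d -> leibniz d) ->
    (forall d e, H d -> H e -> H (comm d e)) ->
    (forall d a, H d -> exists k, iter k d a = 0) ->
    (forall j, H (t j)) -> (forall j i, ring_gen (range x) (t j (x i))) ->
  forall i, exists k, killed t k (x i).
Proof.
move=> HD HM Hcomm Hnil Ht tx i.
have [eta etaX] : exists eta : {rmorphism {mpoly int[n]} -> A}, forall i, eta 'X_i = x i.
  by exists (mmap intr x) => l; rewrite /= mmapX mmap1U.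
pose L : set ({mpoly int[n]} -> {mpoly int[n]}) := [set D |
  [/\ additive_map D, leibniz D & exists2 d, H d & forall p, eta (D p) = d (eta p)]].
pose Q : set {mpoly int[n]} := [set p | eta p = 0].
have main p : tnil app L Q p.
  apply: (engel_derivations (zs := fun i => 'X_i : {mpoly int[n]})).
  - exact: mpoly_int_generated.
  - by move=> d [].
  - by move=> d [].
  - move=> D E [DD DM [d Hd hd]] [ED EM [e He he]]; split.
    + by move=> p1 p2; rewrite /comm ED DD DD ED opprD addrACA.
    + by move=> p1 p2; rewrite /comm EM DD !DM ED !EM; ring.
    + by exists (comm d e); [exact: Hcomm|move=> p'; rewrite /comm rmorphB hd he he hd].
  - split=> //; first exact: rmorph0.
    by move=> a u v _ hu hv; rewrite /Q /= rmorphD rmorphM hu hv mulr0 addr0.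
  - move=> D p' [_ _ [d Hd hd]]; rewrite /Q /= hd => ->.
    by rewrite additive_map0 //; apply: HD.
  - move=> D p' [_ _ [d Hd hd]]; have [k hk] := Hnil d (eta p') Hd.
    exists k; rewrite /Q /= -hk; elim: k {hk} => //= k ih.
    by rewrite hd ih.
have /choice[T hT] : forall j, exists D, L D /\ forall p, eta (D p) = t j (eta p).
  move=> j; have [D [DD DM hD]] := lift_to_polynomials etaX (HD _ (Ht j)) (HM _ (Ht j)) (tx j).
  by exists D; split=> //; split=> //; exists (t j).
rewrite -etaX; elim: (main 'X_i) => [p ->|p _ ih]; first by exists 0%N.
have /choice[k hk] : forall j, exists k, killed t k (t j (eta p)).
  by move=> j; have [k hk] := ih (T j) (hT j).1; exists k; rewrite -(hT j).2.
exists (\max_j k j).+1 => j.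
apply: (killed_le _ _ (hk j)); first by move=> j'; apply: HD.
exact: leq_bigmax.
Qed.

Section LieNilpotency.
Variables (Phi : comPzRingType) (A : comPzAlgType Phi).

Lemma submodule_gen_sub (V : lmodType Phi) (S M : set V) :
  submodule M -> S `<=` M -> submodule_gen S `<=` M.
Proof. by move=> hM hS v; apply; split. Qed.

Lemma submodule_gen0 (V : lmodType Phi) (S : set V) : submodule_gen S 0.
Proof. by move=> M [[]]. Qed.

Variables (s : seq A) (t : seq (der A)).
Hypothesis sgen : subalgebra_gen [set` s] = [set: A].
Let tj (j : 'I_(size t)) : A -> A := t`_j.

Let tjD j : additive_map (tj j).
Proof. by move=> a b; apply: der_atD. Qed.

Let killedZ k c a : killed tj k a -> killed tj k (c *: a).
Proof.
elim: k a => [a ->|k ih a ha j]; first by rewrite /= scaler0.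
by rewrite /tj der_atZ; apply: ih; apply: ha.
Qed.

(** Truncated subtraction is meant: [lowering i] kills [killed tj k] for
    [k <= i]. *)
Let lowering i : set (der A) :=
  [set d | forall k a, killed tj k a -> killed tj (k - i) ((d : A -> A) a)].

Let lowering_submodule i : submodule (lowering i).
Proof.
split=> [k a _|c d e hd he k a ha]; first exact: killed0.
rewrite der_add der_scale; apply: killedD => //; last exact: he.
by apply: killedZ; apply: hd.
Qed.

Let lowering_comm i j d e : lowering i d -> lowering j e -> lowering (i + j) (lie d e).
Proof.
move=> hd he k a ha; rewrite [_ a]der_commE; apply: killedD => //.
  by rewrite addnC subnDA; apply/hd/he.
by rewrite -der_atN subnDA; apply/he; rewrite -der_atN -scaleN1r; apply/hd/killedZ.
Qed.

(** The filtration of [A] by [killed] induces a filtration of the derivations by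
    [lowering], additive under brackets.  The generators [t] have degree one, so
    the lower central series has increasing degrees, and a derivation of
    large degree vanishes on the generators [s]. *)
Lemma words_nilpotent : (forall a, a \in s -> exists k, killed tj k a) ->
  lie_nilpotent (lie_gen [set` t]).
Proof.
move=> hs; set H := lie_gen _.
have t1 d : d \in t -> lowering 1 d.
  move=> dt k a; have it : (index d t < size t)%N by rewrite index_mem.
  case: k => [->|k ha]; first by rewrite der_at0; apply: killed0.
  rewrite subn1 /=; have := ha (Ordinal it).
  by rewrite /tj /= nth_index.
have lowering_le i d : lowering i.+1 d -> lowering i d.
  move=> h k a /h; apply: killed_le => //; exact: leq_sub2l.
have H1 : H `<=` lowering 1.
  move=> d; apply; split=> //; split; first exact: lowering_submodule.
  by move=> d' e hd he; apply: (lowering_le 1%N); exact: (lowering_comm hd he).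
have Hn n : lower_central H n `<=` lowering n.+1.
  elim: n => [//|n ih]; apply: submodule_gen_sub; first exact: lowering_submodule.
  move=> _ [d [e [/ih hd /H1 he ->]]]; rewrite -addn1; exact: lowering_comm.
have [N hN] : exists N, forall a, a \in s -> killed tj N a.
  elim: (s) hs => [_|a s' ih hs]; first by exists 0%N.
  have [N hN] := ih (fun b bs => hs b (mem_behead (s := a :: s') bs)).
  have [k hk] := hs a (mem_head _ _).
  exists (maxn N k) => b; rewrite inE => /orP[/eqP ->|/hN h].
    exact: (killed_le tjD (leq_maxr N k) hk).
  exact: (killed_le tjD (leq_maxl N k) h).
exists N; apply/seteqP; split=> [d|_ ->]; last first.
  case: N {hN} => [|N]; last exact: submodule_gen0.
  by move=> M [[[M0 _] _] _].
move=> /Hn hd; apply: derP => a; rewrite der0.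
have hds b : b \in s -> d b = 0.
  move=> /hN/hd; suff -> : (N - N.+1)%N = 0%N by [].
  by apply/eqP; rewrite subn_eq0.
have : subalgebra_gen [set` s] a by rewrite sgen.
move=> /(_ [set b | d b = 0]); apply; split=> //=; split=> /=.
- split=> [|c u v /= hu hv]; first exact: der_at0.
  by rewrite der_atD der_atZ hu hv scaler0 addr0.
- exact: (leibniz1 (der_leibniz d)).
- by move=> u v hu hv; rewrite der_leibniz hu hv mul0r mulr0 addr0.
Qed.

Lemma scale_add_ring c (u v : A) : c *: u + v = (c *: (1 : A)) * u - (0 - v).
Proof. by rewrite -pzscalerAl mul1r sub0r opprK. Qed.

(** Finitely many elements of [A] already lie in a subring of finite type: only
    finitely many scalars occur in their expressions.  This replaces the
    arbitrary base ring by the integers. *)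
Lemma ring_gen_scalars (k : nat) (f : 'I_k -> A) :
  exists cs : seq Phi, forall i, ring_gen [set` s ++ [seq c *: (1 : A) | c <- cs]] (f i).
Proof.
have mono (cs cs' : seq Phi) : {subset cs <= cs'} ->
    ring_gen [set` s ++ [seq c *: (1 : A) | c <- cs]] `<=`
    ring_gen [set` s ++ [seq c *: (1 : A) | c <- cs']].
  move=> h a; elim=> [b|||]; [|exact: ring_gen1|by move=> *; apply: ring_genB|
    by move=> *; apply: ring_genM].
  rewrite /= mem_cat => hb; apply: ring_gen_in; rewrite /= mem_cat.
  case/orP: hb => [->//|/mapP[c cc ->]].
  by apply/orP; right; apply: (map_f (fun c => c *: (1 : A))); apply: h.
have one a : exists cs : seq Phi, ring_gen [set` s ++ [seq c *: (1 : A) | c <- cs]] a.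
  have : subalgebra_gen [set` s] a by rewrite sgen.
  move=> /(_ [set a | exists cs : seq Phi, ring_gen [set` s ++ [seq c *: (1 : A) | c <- cs]] a]).
  apply; split=> /=; last first.
    by move=> b bs; exists [::]; apply: ring_gen_in; rewrite /= mem_cat bs.
  have cat (cs cs' : seq Phi) a' b : ring_gen [set` s ++ [seq c *: (1 : A) | c <- cs]] a' ->
      ring_gen [set` s ++ [seq c *: (1 : A) | c <- cs']] b ->
      ring_gen [set` s ++ [seq c *: (1 : A) | c <- cs ++ cs']] a' /\
      ring_gen [set` s ++ [seq c *: (1 : A) | c <- cs ++ cs']] b.
    by move=> ha hb; split; [apply: mono ha|apply: mono hb] => c hc; rewrite mem_cat hc ?orbT.
  split.
  - split; first by exists [::]; rewrite -(subrr 1); apply: ring_genB; apply: ring_gen1.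
    move=> c u v [cs hu] [cs' hv]; have [hu' hv'] := cat _ _ _ _ hu hv.
    exists (c :: cs ++ cs'); have sub : {subset cs ++ cs' <= c :: cs ++ cs'}.
      by move=> e he; rewrite inE he orbT.
    have {}hu' := mono _ _ sub _ hu'; have {}hv' := mono _ _ sub _ hv'.
    rewrite scale_add_ring.
    apply: ring_genB; first apply: ring_genM => //.
      by apply: ring_gen_in; rewrite /= mem_cat orbC /= mem_head.
    apply: ring_genB => //; rewrite -(subrr 1); apply: ring_genB; exact: ring_gen1.
  - by exists [::]; apply: ring_gen1.
  - move=> u v [cs hu] [cs' hv]; have [hu' hv'] := cat _ _ _ _ hu hv.
    by exists (cs ++ cs'); apply: ring_genM.
elim: k f => [|k ih] f; first by exists [::] => -[].
have [cs hcs] := ih (fun i => f (lift ord0 i)); have [cs' hcs'] := one (f ord0).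
exists (cs ++ cs') => i; case: (unliftP ord0 i) => [j ->|->].
  by apply: mono (hcs j) => c hc; rewrite mem_cat hc.
by apply: mono hcs' => c hc; rewrite mem_cat hc orbT.
Qed.
End LieNilpotency.

Definition nonzero_ring (B : comPzRingType) (h : (1 : B) != 0) : comNzRingType :=
  HB.pack (GRing.ComPzRing.sort B) (GRing.PzSemiRing_isNonZero.Build B h).

Theorem theorem1p4 (Phi : comPzRingType) (A : comPzAlgType Phi)
  (hA : fin_gen_algebra A) (L : set (der A)) (hL : lie_subalgebra L)
  (hnil : forall d : der A, L d -> locally_nilpotent_der d) :
  lie_locally_nilpotent L.
Proof.
move=> H [Hsub Hlie] HL [t Ht]; have [s sgen] := hA.
rewrite Ht; apply: words_nilpotent (sgen) _ => a0 a0s.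
have [A10|/eqP A10] := pselect ((1 : A) = 0).
  by exists 0%N => /=; rewrite -[a0]mulr1 A10 mulr0.
pose N : comNzRingType := nonzero_ring (B := A) A10.
have [cs hcs] := ring_gen_scalars sgen (k := size t * size s)
  (* the index [j * size s + l] stands for the pair [(j, l)] *)
  (fun i => (t`_(i %/ size s)%N : der A) s`_(i %% size s)%N).
pose gs := s ++ [seq c *: (1 : A) | c <- cs].
have igs : (index a0 gs < size gs)%N by rewrite index_mem mem_cat a0s.
have -> : a0 = gs`_(index a0 gs) by rewrite nth_index // mem_cat a0s.
have tH j : (j < size t)%N -> H (t`_j).
  by move=> jt; rewrite Ht => M [_]; apply; apply: mem_nth.
apply: (@engel_words N (size gs) (fun i => gs`_i) [set (d : A -> A) | d in H] (size t)
  (fun j => (t`_j : der A)) _ _ _ _ _ _ (Ordinal igs)).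
- by move=> _ [d Hd <-] a b; apply: der_atD.
- by move=> _ [d Hd <-]; apply: der_leibniz.
- move=> _ _ [d Hd <-] [e He <-]; exists (lie d e); first exact: Hlie.
  by apply/funext => a.
- move=> _ a [d Hd <-]; have [k [_ hk]] := hnil _ (HL _ Hd) a.
  by exists k.
- by move=> j; exists t`_j => //; apply: tH.
move=> j i.
have conv a : ring_gen [set` gs] a -> @ring_gen N (range (fun i : 'I_(size gs) => gs`_i)) a.
  elim=> [b bgs| |b c _ hb _ hc|b c _ hb _ hc].
  - apply: ring_gen_in; have ib : (index b gs < size gs)%N by rewrite index_mem.
    by exists (Ordinal ib) => //=; rewrite nth_index.
  - exact: (@ring_gen1 N).
  - exact: (@ring_genB N).
  - exact: (@ring_genM N).
apply: conv; have [lt|ge] := ltnP i (size s).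
  have -> : gs`_i = s`_i by rewrite nth_cat lt.
  have lk : (j * size s + i < size t * size s)%N.
    apply: leq_trans (_ : j.+1 * size s <= _)%N; first by rewrite mulSn addnC ltn_add2r.
    by rewrite leq_mul2r ltn_ord orbT.
  have s0 : (0 < size s)%N by apply: leq_ltn_trans lt.
  have := hcs (Ordinal lk); rewrite /= modnMDl modn_small //.
  by rewrite divnMDl // divn_small // addn0.
have lt : (i - size s < size cs)%N.
  by rewrite ltn_subLR // -(size_map (fun c => c *: (1 : A))) -size_cat ltn_ord.
have -> : gs`_i = cs`_(i - size s) *: (1 : A).
  by rewrite nth_cat ltnNge ge /= (nth_map 0).
rewrite der_atZ.
by rewrite (leibniz1 (der_leibniz (t`_j))) scaler0 -(subrr 1); apply: ring_genB; apply: ring_gen1.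
Qed.
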